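(* Let $G$ be a graph that does not satisfy the strong bunkbed conjecture. Then $G$ contains the diamond graph $D$ as a minor and, more generally, $G$ contains at least one of the following two graphs as a minor: the graph obtained from the $5$-cycle $C_5$ by adding one chord (equivalently, $D$ with one of the four edges incident to a degree-$2$ vertex subdivided once), or the complete bipartite graph $K_{2,3}$ (equivalently, $D$ with the edge between its two degree-$3$ vertices subdivided once).
   Context: All graphs are finite and simple; an edge between $v$ and $w$ is written $vw=\{v,w\}$. Bunkbed graph: for a graph $G$, $B(G)$ has vertex set $V(G)\times\{0,1\}$; write $v_i=(v,i)$ and, for $e=xy\in E(G)$, $e_i=x_iy_i$. Its edges are the horizontal edges $e_i$ ($e\in E(G)$, $i\in\{0,1\}$) and the posts $v_0v_1$ ($v\in V(G)$). Percolation: for $T\subseteq V(G)$ and $\vec p=(p_e)_{e\in E(G)}\in[0,1]^{E(G)}$, $B^T=B^T(G,\vec p)$ is the random subgraph of $B(G)$ containing all vertices of $B(G)$, in which each horizontal edge $e_i$ is present with probability $p_e$, independently of all other horizontal edges, and each post $v_0v_1$ is deterministically present if and only if $v\in T$. Write $a\overset{B^T}{\longleftrightarrow}b$ if there is a path between $a$ and $b$ in $B^T$. For $v,w\in V(G)$, $\mathscr B(G,T,\vec p,v,w)$ denotes the statement $\mathbb P(v_0\overset{B^T}{\longleftrightarrow}w_0)\ge\mathbb P(v_0\overset{B^T}{\longleftrightarrow}w_1)$. $G$ satisfies the strong bunkbed conjecture if $\mathscr B(G,T,\vec p,v,w)$ holds for all $T\subseteq V(G)$, $\vec p\in[0,1]^{E(G)}$,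 $v,w\in V(G)$. The diamond graph $D$ is $K_4$ with one edge deleted. A minor of $G$ is any graph that (up to isomorphism) arises from $G$ by deleting and/or contracting edges and deleting isolated vertices (loops and multiple edges arising from contraction are discarded); every graph is a minor of itself. *)

(* Defs.v *)
From mathcomp Require Import all_boot all_order all_algebra.
From mathcomp Require Import reals.

Set Implicit Arguments.
Unset Strict Implicit.
Unset Printing Implicit Defensive.

Import Order.TTheory GRing.Theory Num.Theory.

Record sgraph := SGraph {
  vertex :> finType;
  adj : rel vertex;
  adj_sym : symmetric adj;
  adj_irr : irreflexive adj
}.

Definition edges (G : sgraph) : {set {set G}} :=
  [set [set u.1; u.2] | u : G * G & adj u.1 u.2].

Definition isomorphic (G H : sgraph) : Prop :=
  exists2 f : G -> H, bijective f & forall x y, adj (f x) (f y) = adj x y.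

Section Operations.
Variables (G : sgraph) (x y : G).

Definition del_edge_rel : rel G :=
  fun u v => adj u v && ([set u; v] != [set x; y]).

Fact del_edge_sym : symmetric del_edge_rel.
Proof. by move=> u v; rewrite /del_edge_rel adj_sym setUC. Qed.

Fact del_edge_irr : irreflexive del_edge_rel.
Proof. by move=> u; rewrite /del_edge_rel adj_irr. Qed.

Definition del_edge : sgraph := SGraph del_edge_sym del_edge_irr.

Definition add_edge_rel : rel G :=
  fun u v => (u != v) && (adj u v || ([set u; v] == [set x; y])).

Fact add_edge_sym : symmetric add_edge_rel.
Proof. by move=> u v; rewrite /add_edge_rel adj_sym setUC eq_sym. Qed.

Fact add_edge_irr : irreflexive add_edge_rel.
Proof. by move=> u; rewrite /add_edge_rel eqxx. Qed.

(* The edge xy is only added when x != y. *)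
Definition add_edge : sgraph := SGraph add_edge_sym add_edge_irr.

(* Contraction of the edge xy: y is removed and x plays the role of the merged
   vertex, inheriting the neighbours of y. The conjunct u != v discards the
   loop; parallel edges are merged because adjacency is a relation. *)
Definition contract_rel : rel {v : G | v != y} :=
  fun u v => (u != v) &&
    [|| adj (val u) (val v),
        (val u == x) && adj y (val v)
      | (val v == x) && adj (val u) y].

Fact contract_sym : symmetric contract_rel.
Proof.
move=> u v; rewrite /contract_rel eq_sym (adj_sym (val u) (val v)).
by rewrite (adj_sym y (val v)) (adj_sym (val u) y) [in RHS]orbCA orbA orbC
  [in RHS]orbC orbCA -!orbA; do !bool_congr.
Qed.

Fact contract_irr : irreflexive contract_rel.
Proof. by move=> u; rewrite /contract_rel eqxx. Qed.

Definition contract : sgraph := SGraph contract_sym contract_irr.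

Definition del_vertex_rel : rel {v : G | v != x} :=
  fun u v => adj (val u) (val v).

Fact del_vertex_sym : symmetric del_vertex_rel.
Proof. by move=> u v; apply: adj_sym. Qed.

Fact del_vertex_irr : irreflexive del_vertex_rel.
Proof. by move=> u; apply: adj_irr. Qed.

Definition del_vertex : sgraph := SGraph del_vertex_sym del_vertex_irr.

(* Subdivision of the edge xy: None is the new vertex. *)
Definition subdivide_rel : rel (option G) := fun u v =>
  match u, v with
  | Some a, Some b => del_edge_rel a b
  | Some a, None | None, Some a => a \in [set x; y]
  | None, None => false
  end.

Fact subdivide_sym : symmetric subdivide_rel.
Proof. by move=> [a|] [b|] //=; apply: del_edge_sym. Qed.

Fact subdivide_irr : irreflexive subdivide_rel.
Proof. by move=> [a|] //=; apply: del_edge_irr. Qed.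

Definition subdivide : sgraph := SGraph subdivide_sym subdivide_irr.

End Operations.

Inductive has_minor (G H : sgraph) : Prop :=
| minor_iso of isomorphic G H
| minor_del_edge (x y : G) of adj x y & has_minor (del_edge x y) H
| minor_contract (x y : G) of adj x y & has_minor (contract x y) H
| minor_del_vertex (x : G) of (forall v, ~~ adj x v)
    & has_minor (del_vertex x) H.

Fact complete_sym n : symmetric (fun u v : 'I_n => u != v).
Proof. by move=> u v; rewrite eq_sym. Qed.

Fact complete_irr n : irreflexive (fun u v : 'I_n => u != v).
Proof. by move=> u; rewrite eqxx. Qed.

Definition complete n : sgraph := SGraph (@complete_sym n) (@complete_irr n).

Definition cycle_rel n : rel 'I_n :=
  fun u v => (u != v) && ((v == u.+1 %% n :> nat) || (u == v.+1 %% n :> nat)).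

Fact cycle_sym n : symmetric (@cycle_rel n).
Proof. by move=> u v; rewrite /cycle_rel eq_sym orbC. Qed.

Fact cycle_irr n : irreflexive (@cycle_rel n).
Proof. by move=> u; rewrite /cycle_rel eqxx. Qed.

Definition cycle_graph n : sgraph := SGraph (@cycle_sym n) (@cycle_irr n).

Definition biclique_rel m n : rel ('I_m + 'I_n) := fun u v =>
  match u, v with inl _, inr _ | inr _, inl _ => true | _, _ => false end.

Fact biclique_sym m n : symmetric (@biclique_rel m n).
Proof. by move=> [a|a] [b|b]. Qed.

Fact biclique_irr m n : irreflexive (@biclique_rel m n).
Proof. by move=> [a|a]. Qed.

Definition biclique m n : sgraph :=
  SGraph (@biclique_sym m n) (@biclique_irr m n).

(* The degree-2 vertices of the diamond are 2 and 3. *)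
Definition diamond : sgraph :=
  @del_edge (complete 4) (inord 2) (inord 3).

Definition C5_chord : sgraph :=
  @add_edge (cycle_graph 5) (inord 0) (inord 2).

Definition K23 : sgraph := biclique 2 3.

Fact eq_pair_set (V : finType) (u v x y : V) :
  ([set u; v] == [set x; y])
  = ((u == x) && (v == y)) || ((u == y) && (v == x)).
Proof.
apply/eqP/idP => [E|/orP[]/andP[/eqP-> /eqP->] //]; last by rewrite setUC.
have: [&& u \in [set x; y], v \in [set x; y],
         x \in [set u; v] & y \in [set u; v]].
  by rewrite -{1 2}E E !set21 !set22 -E set21 set22.
rewrite !inE (eq_sym x u) (eq_sym x v) (eq_sym y u) (eq_sym y v).
by do 4!case: (_ == _).
Qed.

(* The equivalent descriptions of the last two graphs as subdivisions of the
   diamond. *)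
Fact C5_chord_subdivide :
  isomorphic C5_chord (@subdivide diamond (inord 0) (inord 2)).
Proof.
pose f (i : 'I_5) : option 'I_4 := nth None
  [:: Some (inord 0); Some (inord 3); Some (inord 1); Some (inord 2)] i.
exists f.
  apply: inj_card_bij; last by rewrite card_option !card_ord.
  move=> [[|[|[|[|[|i]]]]] // ?] [[|[|[|[|[|j]]]]] // ?]; rewrite /f //=;
  by [move=> _; apply/val_inj | move=> [/(congr1 val)]; rewrite /= !inordK].
move=> [[|[|[|[|[|i]]]]] // ?] [[|[|[|[|[|j]]]]] // ?];
by rewrite /f /= /add_edge_rel /del_edge_rel /= /del_edge_rel /= ?inE
  ?eq_pair_set /cycle_rel -?val_eqE /= ?inordK.
Qed.

Fact K23_subdivide :
  isomorphic K23 (@subdivide diamond (inord 0) (inord 1)).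
Proof.
pose f (i : 'I_2 + 'I_3) : option 'I_4 :=
  match i with
  | inl i => Some (inord i)
  | inr i => nth None [:: Some (inord 2); Some (inord 3)] i
  end.
exists f.
  apply: inj_card_bij; last by rewrite card_option card_sum !card_ord.
  move=> [[[|[|i]] // ?]|[[|[|[|i]]] // ?]] [[[|[|j]] // ?]|[[|[|[|j]]] // ?]];
  rewrite /f //=;
  by [move=> _; congr (_ _); apply/val_inj
     | move=> [/(congr1 val)]; rewrite /= !inordK].
move=> [[[|[|i]] // ?]|[[|[|[|i]]] // ?]] [[[|[|j]] // ?]|[[|[|[|j]]] // ?]];
by rewrite /f /= ?/del_edge_rel /= ?/del_edge_rel /= ?inE
  ?eq_pair_set -?val_eqE /= ?inordK.
Qed.

(* In V(G) x {0,1} the layers 0 and 1 are [false] and [true]. *)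
Definition bunkbed_rel (G : sgraph) : rel (G * bool) := fun a b =>
  (a.2 == b.2) && adj a.1 b.1 || (a.1 == b.1) && (a.2 != b.2).

Fact bunkbed_sym (G : sgraph) : symmetric (@bunkbed_rel G).
Proof.
move=> a b; rewrite /bunkbed_rel adj_sym.
by rewrite (eq_sym a.1) (eq_sym a.2).
Qed.

Fact bunkbed_irr (G : sgraph) : irreflexive (@bunkbed_rel G).
Proof. by move=> a; rewrite /bunkbed_rel adj_irr !eqxx. Qed.

Definition bunkbed (G : sgraph) : sgraph :=
  SGraph (@bunkbed_sym G) (@bunkbed_irr G).

(* The horizontal edge e_i of the bunkbed graph is encoded as the pair (e, i);
   an outcome of the percolation is the set of horizontal edges present. *)
Definition outcome (G : sgraph) := {set {set G} * bool}.

Definition horizontal (G : sgraph) : outcome G := setX (edges G) [set: bool].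

Section Percolation.
Variables (G : sgraph) (T : {set G}).

Definition perc_rel (omega : outcome G) : rel (bunkbed G) := fun a b =>
  adj a b && (if a.2 == b.2 then ([set a.1; b.1], a.2) \in omega
              else a.1 \in T).

Fact perc_sym omega : symmetric (perc_rel omega).
Proof.
move=> a b; rewrite /perc_rel adj_sym setUC eq_sym /= /bunkbed_rel.
by have [->|_] := eqVneq b.2 a.2; rewrite ?andbF //=; case: eqVneq => // ->.
Qed.

Fact perc_irr omega : irreflexive (perc_rel omega).
Proof. by move=> a; rewrite /perc_rel adj_irr. Qed.

Definition perc_graph (omega : outcome G) : sgraph :=
  SGraph (perc_sym omega) (perc_irr omega).

Variables (R : realType) (p : {set G} -> R).

Local Open Scope ring_scope.

Definition perc_weight (omega : outcome G) : R :=
  \prod_(h in horizontal G) (if h \in omega then p h.1 else 1 - p h.1).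

Definition perc_prob (A : pred (outcome G)) : R :=
  \sum_(omega in powerset (horizontal G) | A omega) perc_weight omega.

Definition prob_connected (a b : bunkbed G) : R :=
  perc_prob (fun omega => connect (@adj (perc_graph omega)) a b).

Definition bunkbed_ineq (v w : G) : Prop :=
  prob_connected (v, false) (w, false) >= prob_connected (v, false) (w, true).

End Percolation.

(* Only the values of p on the edges of G matter. *)
Definition strong_bunkbed (R : realType) (G : sgraph) : Prop :=
  forall (T : {set G}) (p : {set G} -> R),
    (forall e, e \in edges G -> (0 <= p e <= 1)%R) ->
    forall v w : G, bunkbed_ineq T p v w.

(* Main.v *)
(** Reversing, for any set of edges, which layer each copy lies in preserves
    the percolation measure.  Averaging over all reversals reduces the claim to
    a counting inequality: edges absent from both layers are deleted, edges
    present in both are contracted, and every remaining edge is present in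
    exactly one layer, given by a fair coin (its colour).

    In this polarised model, a graph whose inequality does not follow from that
    of smaller minors has no parallel edges, no edge inside T, no vertex of
    degree two outside T, v and w, and no cut vertex.  For the cut vertex z,
    the difference for v and w on opposite sides is the product of the
    differences for (v, z) and (z, w).  With at most four vertices the
    inequality is a finite computation.  With at least five vertices there is a
    vertex of degree at least three.  Take a longest cycle: a vertex off it
    gives an ear whose ends, by maximality, are not consecutive, hence K_{2,3},
    and otherwise the cycle is Hamiltonian and has a chord, which gives C_5
    plus a chord. *)

Require Import Defs.
From mathcomp Require Import all_boot all_order all_algebra.
From mathcomp Require Import boolp reals zify.

Set Implicit Arguments.
Unset Strict Implicit.
Unset Printing Implicit Defensive.

Import Order.TTheory GRing.Theory Num.Theory.

(** * Layered graphs and the polarised model *)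

Lemma connect_hom (A B : finType) (r : rel A) (r' : rel B) (h : A -> B) :
  (forall a b, r a b -> connect r' (h a) (h b)) ->
  forall a b, connect r a b -> connect r' (h a) (h b).
Proof.
move=> hr a b /connectP[p]; elim: p a => [|x p IH] a /=; first by move=> _ ->.
by case/andP=> /hr hax /IH hp /hp; apply: connect_trans.
Qed.

Lemma connect_invariant (A : finType) (r : rel A) (P : pred A) :
  (forall a b, r a b -> P a -> P b) ->
  forall a b, connect r a b -> P a -> P b.
Proof.
move=> hr a b /connectP[p]; elim: p a => [|x p IH] a /=; first by move=> _ ->.
by case/andP=> /hr hax /IH hp /hp hb /hax.
Qed.

Section Layers.
Variables (V E : finType).
Implicit Types (g : E -> V * V) (T : {set V}) (op : E -> bool -> bool).
Implicit Types (F : {set E}) (c : {ffun E -> bool}).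

(** Edges are abstract labels with an end map [g], so loops and parallel edges are allowed and a
    contraction changes only [g]. *)
Definition joins g (e : E) : rel V := fun x y =>
  (g e == (x, y)) || (g e == (y, x)).

(** [op e i] says that the copy of [e] in layer [i] is open. A post also relates a point to itself,
    which does not affect connectivity. *)
Definition layers g T op : rel (V * bool) := fun a b =>
  (a.1 == b.1) && (a.1 \in T) ||
  [exists e, [&& a.2 == b.2, op e a.2 & joins g e a.1 b.1]].

Definition conn g T op := connect (layers g T op).

Lemma joinsC g e x y : joins g e x y = joins g e y x.
Proof. by rewrite /joins orbC. Qed.

Lemma conn_refl g T op a : conn g T op a a.
Proof. exact: connect0. Qed.

Lemma layers_sym g T op : symmetric (layers g T op).
Proof.
move=> a b; rewrite /layers eq_sym.
congr (_ || _); first by case: eqP => // ->.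
by apply: eq_existsb => e; rewrite eq_sym joinsC; case: eqP => //= ->.
Qed.

Lemma conn_sym g T op : symmetric (conn g T op).
Proof. by apply: sym_connect_sym; apply: layers_sym. Qed.

Lemma conn_post g T op x i j : x \in T -> conn g T op (x, i) (x, j).
Proof. by move=> xT; apply: connect1; rewrite /layers /= eqxx xT. Qed.

Lemma conn_edge g T op e x y i :
  op e i -> joins g e x y -> conn g T op (x, i) (y, i).
Proof.
move=> oe je; apply: connect1; apply/orP; right.
by apply/existsP; exists e; rewrite /= eqxx oe.
Qed.

Lemma conn_trans g T op a b d :
  conn g T op a b -> conn g T op b d -> conn g T op a d.
Proof. exact: connect_trans. Qed.

Lemma conn_hom (B : finType) (r : rel B) (h : V * bool -> B) g T op :
  connect_sym r ->
  (forall x, x \in T -> connect r (h (x, false)) (h (x, true))) ->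
  (forall e i, op e i -> connect r (h ((g e).1, i)) (h ((g e).2, i))) ->
  forall a b, conn g T op a b -> connect r (h a) (h b).
Proof.
move=> rS hT ho; apply: connect_hom => -[a i] [b j]; rewrite /layers /=.
case/orP=> [/andP[/eqP<- aT]|/existsP[e /and3P[/eqP<- oe]]].
  by case: i j => [] []; rewrite ?connect0 ?hT // rS hT.
by case/orP=> /eqP ge; have := ho _ _ oe; rewrite ge // rS.
Qed.

Lemma conn_sub g T op T' op' :
  (forall x, x \in T -> conn g T' op' (x, false) (x, true)) ->
  (forall e i, op e i -> conn g T' op' ((g e).1, i) ((g e).2, i)) ->
  forall a b, conn g T op a b -> conn g T' op' a b.
Proof. by move=> hT ho; apply: (@conn_hom _ _ id) => //; apply: conn_sym. Qed.

Lemma joins_ends g e : joins g e (g e).1 (g e).2.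
Proof. by rewrite /joins -surjective_pairing eqxx. Qed.

Lemma conn_open g T op e i : op e i -> conn g T op ((g e).1, i) ((g e).2, i).
Proof. by move=> oe; apply: conn_edge oe (joins_ends g e). Qed.

Lemma conn_reflect g T op a b :
  conn g T op (a.1, ~~ a.2) (b.1, ~~ b.2) =
  conn g T (fun e i => op e (~~ i)) a b.
Proof.
suff imp op' a' b' : conn g T op' a' b' ->
    conn g T (fun e i => op' e (~~ i)) (a'.1, ~~ a'.2) (b'.1, ~~ b'.2).
  apply/idP/idP => [/imp/=|/imp]; rewrite ?negbK -?surjective_pairing //.
  by apply: conn_sub => [x|e i]; [apply: conn_post | rewrite negbK; apply: conn_open].
apply: (@conn_hom _ _ (fun a => (a.1, ~~ a.2))) => [|x xT|e i oe] /=.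
- exact: conn_sym.
- exact: conn_post.
- by apply: (@conn_open _ _ (fun e i => op' e (~~ i))); rewrite negbK.
Qed.

Lemma eq_conn g T op op' a b :
  (forall e i, op e i = op' e i) -> conn g T op a b = conn g T op' a b.
Proof.
move=> eo; apply/idP/idP; apply: conn_sub => [x|e i];
by [apply: conn_post | rewrite ?eo => oe; apply: conn_open; rewrite ?eo].
Qed.

(** Contraction stays on the type [V]: for distinct [x] and [y], the vertex [y] is kept but loses
    its edges and its post. *)
Definition identify (x y : V) (u : V) : V := if u == y then x else u.

Definition contract_ends (x y : V) g e := (identify x y (g e).1, identify x y (g e).2).

(** Merging preserves connections. Conversely, each point is connected to its image in its own layer
    ([mK]), so a path after the contraction lifts step by step. *)
Lemma conn_contract g T op x y :
  (forall i, conn g T op (x, i) (y, i)) -> forall a b,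
  conn g T op a b =
  conn (contract_ends x y g) (identify x y @: T) op
       (identify x y a.1, a.2) (identify x y b.1, b.2).
Proof.
move=> xy [a i] [b j] /=.
have mK u k : conn g T op (identify x y u, k) (u, k).
  by rewrite /identify; case: eqP => [->//|_]; apply: conn_refl.
apply/idP/idP.
  apply: (@conn_hom _ _ (fun a => (identify x y a.1, a.2))) => [|u uT|e k oe] /=.
  - exact: conn_sym.
  - by apply: conn_post; apply: imset_f.
  - exact: (@conn_open (contract_ends x y g)).
move=> h; apply: conn_trans (mK b j); rewrite conn_sym.
apply: conn_trans (mK a i); rewrite conn_sym.
move: h; apply: (@conn_hom _ _ id) => [|u /imsetP[w wT ->]|e k oe] /=.
- exact: conn_sym.
- apply: conn_trans (mK _ _) _; rewrite conn_sym.
  by apply: conn_trans (mK _ _) _; apply: conn_post.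
- apply: conn_trans (mK _ _) _; rewrite conn_sym.
  by apply: conn_trans (mK _ _) _; rewrite conn_sym; apply: conn_open.
Qed.

Lemma conn_loop g T op e a b : (g e).1 = (g e).2 ->
  conn g T op a b = conn g T (fun e' i => (e' != e) && op e' i) a b.
Proof.
move=> le; apply/idP/idP; apply: conn_sub => [u|e' i].
- exact: conn_post.
- case: (eqVneq e' e) => [->|ne] oe; first by rewrite le; apply: conn_refl.
  by apply: conn_open; rewrite ne.
- exact: conn_post.
- by case/andP=> _; apply: conn_open.
Qed.

(** * Gaps and their sums over colourings *)

Local Open Scope ring_scope.

Definition gap g T op (v w : V) : int :=
  (conn g T op (v, false) (w, false))%:Z - (conn g T op (v, false) (w, true))%:Z.

Definition polar F c (e : E) (i : bool) := (e \in F) && (c e == i).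

(** Colourings range over all of [E]; the colours outside [F] only multiply the sum by a power of
    two. *)
Definition total_gap g T F v w : int :=
  \sum_(c : {ffun E -> bool}) gap g T (polar F c) v w.

Lemma eq_gap g T op op' v w :
  (forall e i, op e i = op' e i) -> gap g T op v w = gap g T op' v w.
Proof. by move=> eo; rewrite /gap !(eq_conn _ _ _ _ eo). Qed.

Lemma gap_contract g T op x y v w :
  (forall i, conn g T op (x, i) (y, i)) ->
  gap g T op v w =
  gap (contract_ends x y g) (identify x y @: T) op (identify x y v) (identify x y w).
Proof. by move=> xy; rewrite /gap !(conn_contract xy). Qed.

Lemma gap_loop g T op e v w : (g e).1 = (g e).2 ->
  gap g T op v w = gap g T (fun e' i => (e' != e) && op e' i) v w.
Proof. by move=> le; rewrite /gap -!(conn_loop T op _ _ le). Qed.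

Definition xorf c c' : {ffun E -> bool} := [ffun e => c e (+) c' e].

Lemma xorfK c : involutive (xorf^~ c).
Proof. by move=> c'; apply/ffunP => e; rewrite !ffunE addbK. Qed.

Lemma sum_xorf (A : nmodType) c (H : {ffun E -> bool} -> A) :
  \sum_c' H c' = \sum_c' H (xorf c' c).
Proof. exact: (reindex_inj (inv_inj (xorfK c))). Qed.

Lemma gap_reflect g T op v w :
  gap g T (fun e i => op e (~~ i)) v w =
  (conn g T op (v, true) (w, true))%:Z - (conn g T op (v, true) (w, false))%:Z.
Proof. by rewrite /gap -!conn_reflect. Qed.

Lemma polar_neg F c e i :
  polar F (xorf c [ffun => true]) e i = polar F c e (~~ i).
Proof. by rewrite /polar !ffunE; case: (c e); case: i. Qed.

Lemma total_gap_true g T F v w :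
  total_gap g T F v w =
  \sum_c ((conn g T (polar F c) (v, true) (w, true))%:Z
          - (conn g T (polar F c) (v, true) (w, false))%:Z).
Proof.
rewrite /total_gap (sum_xorf [ffun => true]); apply: eq_bigr => c _.
by rewrite (eq_gap _ _ _ _ (@polar_neg F c)) gap_reflect.
Qed.

(** Exchanging [v] and [w] reverses the layers in the cross term only, and negating all colours
    undoes this. *)
Lemma total_gapC g T F v w : total_gap g T F v w = total_gap g T F w v.
Proof.
rewrite /total_gap /gap !big_split /=; congr (_ + _).
  by apply: eq_bigr => c _; rewrite conn_sym.
rewrite (sum_xorf [ffun => true]); apply: eq_bigr => c _.
by rewrite (eq_conn _ _ _ _ (@polar_neg F c)) -conn_reflect /= conn_sym.
Qed.

(** With a post at [v] both copies of [v] reach the same points, so the gap seen from one layer is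
    the negative of the gap seen from the other, while the two totals agree. *)
Lemma total_gap_post g T F v w : v \in T -> total_gap g T F v w = 0.
Proof.
move=> vT; suff: total_gap g T F v w + total_gap g T F v w = 0 by lia.
rewrite {2}total_gap_true -big_split big1 //= => c _.
have vE k l : conn g T (polar F c) (v, k) (w, l) =
    conn g T (polar F c) (v, false) (w, l).
  apply/idP/idP; apply: conn_trans; exact: conn_post.
by rewrite /gap !(vE true) addrC subrKA subrr.
Qed.

(* Toggling the colour of e pairs up the colourings, so it suffices to split
   the gap of c plus that of its partner into two nonnegative totals. *)
Lemma sum_toggle_ge0 e (H A B : {ffun E -> bool} -> int) :
  (forall c, H c + H (xorf c [ffun e' => e' == e]) = A c + B c) ->
  0 <= \sum_c A c -> 0 <= \sum_c B c -> 0 <= \sum_c H c.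
Proof.
move=> HAB A0 B0; suff: 0 <= \sum_c H c + \sum_c H c by lia.
rewrite {2}(sum_xorf [ffun e' => e' == e]) -big_split /=.
by rewrite (eq_bigr _ (fun c _ => HAB c)) big_split addr_ge0.
Qed.

(** * Reductions of the polarised model *)

Lemma total_gap_loop g T F e v w : (g e).1 = (g e).2 ->
  total_gap g T (F :\ e) v w = total_gap g T F v w.
Proof.
move=> le; apply: eq_bigr => c _; rewrite [RHS](gap_loop _ _ _ _ le).
by apply: eq_gap => e' i; rewrite /polar !inE andbA.
Qed.

Lemma ends_cases g e x y : joins g e x y -> g e = (x, y) \/ g e = (y, x).
Proof. by case/orP=> /eqP ->; [left|right]. Qed.

Lemma contract_loop g e x y : joins g e x y ->
  (contract_ends x y g e).1 = (contract_ends x y g e).2.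
Proof.
by case/ends_cases=> h; rewrite /contract_ends h /identify /= eqxx; case: eqP.
Qed.

Lemma gap_contract_edge g T op op' e x y v w :
  joins g e x y -> (forall i, conn g T op (x, i) (y, i)) ->
  (forall e' i, e' != e -> op e' i = op' e' i) ->
  gap g T op v w =
  gap (contract_ends x y g) (identify x y @: T) (fun e' i => (e' != e) && op' e' i)
    (identify x y v) (identify x y w).
Proof.
move=> je xy eo; rewrite (gap_contract _ _ xy) (gap_loop _ _ _ _ (contract_loop je)).
by apply: eq_gap => e' i; case: (eqVneq e' e) => // /eo->.
Qed.

Lemma polarD1 F c e e' i : polar (F :\ e) c e' i = (e' != e) && polar F c e' i.
Proof. by rewrite /polar !inE andbA. Qed.

(** If [e] and [e'] have the same colour, [e] is redundant and can be deleted; otherwise [x] and [y]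
    are joined in both layers and can be merged. Toggling the colour of [e] gives one case of each
    kind. *)
Lemma parallel_ge0 g T F e e' x y v w :
  e \in F -> e' \in F -> e != e' -> joins g e x y -> joins g e' x y ->
  0 <= total_gap g T (F :\ e) v w ->
  0 <= total_gap (contract_ends x y g) (identify x y @: T) (F :\ e)
         (identify x y v) (identify x y w) ->
  0 <= total_gap g T F v w.
Proof.
move=> eF e'F ne je je'; apply: (@sum_toggle_ge0 e) => c.
have key c' : (forall f, f != e -> c' f = c f) ->
    gap g T (polar F c') v w =
    if c' e == c e' then gap g T (polar (F :\ e) c) v w
    else gap (contract_ends x y g) (identify x y @: T) (polar (F :\ e) c)
         (identify x y v) (identify x y w).
  move=> cc'; case: eqP => ce.
    have eqc a b : conn g T (polar F c') a b = conn g T (polar (F :\ e) c) a b.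
      apply/idP/idP; apply: conn_sub => [u|f i]; first [exact: conn_post | idtac];
      rewrite ?polarD1.
        case: (eqVneq f e) => [->|nf] /andP[fF /eqP <-].
          have o: polar (F :\ e) c e' (c' e) by rewrite /polar !inE eq_sym ne e'F ce /=.
          case/ends_cases: je => ->; [|rewrite conn_sym]; exact: conn_edge o je'.
        by apply: conn_open; rewrite /polar !inE nf fF -cc' /=.
      case/and3P=> nf fF cf; apply: conn_open.
      by rewrite /polar fF cc'.
    by rewrite /gap !eqc.
  rewrite (@gap_contract_edge _ _ _ (polar F c) e x y) //.
  - by apply: eq_gap => f i; rewrite polarD1.
  - move=> i; case: (eqVneq (c' e) i) => ci.
      by apply: conn_edge je; rewrite /polar eF ci /=.
    apply: conn_edge je'; rewrite /polar e'F cc' 1?eq_sym //=.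
    by move: ce ci; case: (c' e) (c e') i => [] [] [].
  - by move=> f i nf; rewrite /polar cc'.
rewrite !key // => [|f nf]; rewrite ?ffunE ?eqxx ?(negPf nf) ?addbF //.
by case: (c e) (c e') => [] [] /=; rewrite 1?addrC.
Qed.

(** The posts carry the open copy of [e] over to the other layer, so its ends are joined in both
    layers whatever its colour. *)
Lemma posts_ge0 g T F e x y v w :
  e \in F -> joins g e x y -> x \in T -> y \in T ->
  0 <= total_gap (contract_ends x y g) (identify x y @: T) (F :\ e)
         (identify x y v) (identify x y w) ->
  0 <= total_gap g T F v w.
Proof.
move=> eF je xT yT; congr (_ <= _); apply: eq_bigr => c _.
rewrite [RHS](@gap_contract_edge _ _ _ (polar F c) e x y) //.
  by apply: eq_gap => f i; rewrite polarD1.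
move=> i; apply: conn_trans (conn_post _ _ i (c e) xT) _.
apply: conn_trans (conn_post _ _ (c e) i yT).
by apply: conn_edge je; rewrite /polar eF /=.
Qed.

(** With opposite colours both copies of [u] are dead ends, so [e] and [e'] can be deleted. With
    equal colours one copy of [u] subdivides an edge and the other is isolated, so [e] can be
    contracted. Toggling the colour of [e] gives one case of each kind. *)
Lemma series_ge0 g T F e e' u x y v w :
  e \in F -> e' \in F -> e != e' -> joins g e x u -> joins g e' u y ->
  u != x -> u != y -> u \notin T -> u != v -> u != w ->
  (forall f z, f \in F -> joins g f u z -> f = e \/ f = e') ->
  0 <= total_gap g T (F :\ e :\ e') v w ->
  0 <= total_gap (contract_ends x u g) (identify x u @: T) (F :\ e)
         (identify x u v) (identify x u w) ->
  0 <= total_gap g T F v w.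
Proof.
move=> eF e'F ne je je' nux nuy uT nuv nuw du; apply: (@sum_toggle_ge0 e) => c.
have [nxu nyu] : (x == u) = false /\ (y == u) = false.
  by rewrite eq_sym (negPf nux) eq_sym (negPf nuy).
have key c' : (forall f, f != e -> c' f = c f) ->
    gap g T (polar F c') v w =
    if c' e != c e' then gap g T (polar (F :\ e :\ e') c) v w
    else gap (contract_ends x u g) (identify x u @: T) (polar (F :\ e) c)
         (identify x u v) (identify x u w).
  move=> cc'.
  have nu f : f \in F -> f != e -> f != e' -> ((g f).1 != u) /\ ((g f).2 != u).
    move=> fF nfe nfe'; split; apply/eqP => gu.
      have j : joins g f u (g f).2 by rewrite -gu joins_ends.
      by case: (du f _ fF j) => fe; [rewrite fe eqxx in nfe | rewrite fe eqxx in nfe'].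
    have j : joins g f u (g f).1 by rewrite joinsC -gu joins_ends.
    by case: (du f _ fF j) => fe; [rewrite fe eqxx in nfe | rewrite fe eqxx in nfe'].
  case: ifPn => ce.
    have h a b : a.1 != u -> b.1 != u -> conn g T (polar F c') a b =
        conn g T (polar (F :\ e :\ e') c) a b.
      move=> au bu; apply/idP/idP; last first.
        apply: conn_sub => [z|f i]; first exact: conn_post.
        rewrite !polarD1 => /and4P[ne' nfe fF cf]; apply: conn_open.
        by rewrite /polar fF cc'.
      (* Each copy of u is a dead end: move it to the neighbour it hangs on. *)
      pose k a := if a.1 == u then (if a.2 == c' e then x else y, a.2) else a.
      have ku a' : a'.1 != u -> k a' = a' by move/negPf=> h; rewrite /k h.
      rewrite -{2}(ku _ au) -{2}(ku _ bu).
      apply: conn_hom => [|z zT|f i].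
      - exact: conn_sym.
      - have zu: z != u by apply: contraNneq uT => <-.
        by rewrite !ku //; apply: conn_post.
      case/andP=> fF /eqP ci; case: (eqVneq f e) => [fe|nfe].
        have -> : k ((g f).1, i) = k ((g f).2, i).
          rewrite fe; case/ends_cases: je => -> /=; rewrite /k /= eqxx nxu;
          by rewrite -ci fe eqxx.
        exact: conn_refl.
      case: (eqVneq f e') => [fe'|nfe'].
        have -> : k ((g f).1, i) = k ((g f).2, i).
          rewrite fe'; case/ends_cases: je' => -> /=; rewrite /k /= eqxx nyu;
          by rewrite -ci fe' cc' 1?eq_sym // (negPf ce) // eq_sym (negPf ce).
        exact: conn_refl.
      have [n1 n2] := nu f fF nfe nfe'.
      rewrite !ku //; apply: conn_open.
      by rewrite !polarD1 nfe nfe' /polar fF -cc' ?ci /=.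
    by rewrite /gap !h //= eq_sym.
  move: ce; rewrite negbK => /eqP ce.
  (* Opening [e] in both layers only hangs the isolated copy of [u] on [x]; the map [k] below folds
     that copy onto [x]. *)
  pose op f i := (f == e) || polar F c' f i.
  have h a b : a.1 != u -> b.1 != u ->
      conn g T (polar F c') a b = conn g T op a b.
    move=> au bu; apply/idP/idP.
      apply: conn_sub => [z|f i]; first exact: conn_post.
      by move=> o; apply: conn_open; rewrite /op o orbT.
    pose k a := if a == (u, ~~ c' e) then (x, ~~ c' e) else a.
    have ku a' : a'.1 != u -> k a' = a'.
      by move=> h; rewrite /k; case: eqP => // ea; rewrite ea eqxx in h.
    rewrite -{2}(ku _ au) -{2}(ku _ bu).
    apply: conn_hom => [|z zT|f i].
    - exact: conn_sym.
    - have zu: z != u by apply: contraNneq uT => <-.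
      by rewrite !ku //; apply: conn_post.
    case: (eqVneq i (c' e)) => [->|ni].
      have kc z : k (z, c' e) = (z, c' e).
        by rewrite /k xpair_eqE; case: (c' e); rewrite andbF.
      move=> o; rewrite !kc; apply: conn_open; case/orP: o => // /eqP->.
      by rewrite /polar eF /=.
    have ei : i = ~~ c' e by case: i (c' e) ni => [] [].
    case: (eqVneq f e) => [-> _|nfe].
      have -> : k ((g e).1, i) = k ((g e).2, i); last exact: conn_refl.
      by case/ends_cases: je => -> /=; rewrite /k !xpair_eqE ei !eqxx /= andbT nxu.
    rewrite /op (negPf nfe) /= => /andP[fF /eqP ci].
    have nfe' : f != e'.
      by apply: contraNneq ni => fe'; rewrite -ci fe' (cc' e') 1?eq_sym // ce.
    have [n1 n2] := nu f fF nfe nfe'.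
    by rewrite !ku //; apply: conn_open; rewrite /polar fF ci /=.
  rewrite {1}/gap !h //=; first rewrite -/(gap _ _ _ _ _); try by rewrite eq_sym.
  rewrite (@gap_contract_edge _ _ op (polar F c) e x u) //.
  - by apply: eq_gap => f i; rewrite polarD1.
  - by move=> i; apply: conn_edge je; rewrite /op eqxx.
  - by move=> f i nf; rewrite /op (negPf nf) /polar cc'.
rewrite !key // => [|f nf]; rewrite ?ffunE ?eqxx ?(negPf nf) ?addbF //.
by case: (c e) (c e') => [] [] /=; rewrite 1?addrC.
Qed.

End Layers.

(** * Cut vertices *)

Section CutVertex.
Variables (V E : finType) (g : E -> V * V) (T : {set V}) (z : V).

(** One side of a cut vertex [z] acts on the other only by connecting, or not, the two copies of
    [z], that is, by making [z] behave as a post. *)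
Definition side_posts (op : E -> bool -> bool) : {set V} :=
  if conn g T op (z, false) (z, true) then z |: T else T.

Lemma sub_side_posts op x : x \in T -> x \in side_posts op.
Proof. by rewrite /side_posts => xT; case: ifP; rewrite ?inE xT ?orbT. Qed.

Lemma conn_side (A B : {set V}) (op op1 op2 : E -> bool -> bool) :
  (forall x, (x \in A) || (x \in B)) ->
  (forall x, x \in A -> x \in B -> x = z) ->
  (forall e i, op e i = op1 e i || op2 e i) ->
  (forall e i, op1 e i -> ((g e).1 \in A) && ((g e).2 \in A)) ->
  (forall e i, op2 e i -> ((g e).1 \in B) && ((g e).2 \in B)) ->
  forall a b, a.1 \in A -> b.1 \in A ->
  conn g T op a b = conn g (side_posts op2) op1 a b.
Proof.
move=> AB capAB op12 A1 B2 a b aA bA; apply/idP/idP; last first.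
  apply: conn_sub => [x|e i o]; last by apply: conn_open; rewrite op12 o.
  rewrite /side_posts; case: ifPn => [z2|_]; last exact: conn_post.
  rewrite !inE; case/orP=> [/eqP->|]; last exact: conn_post.
  move: z2; apply: conn_sub => [y|e i o]; first exact: conn_post.
  by apply: conn_open; rewrite op12 o orbT.
(* Every component of the side [B] is folded onto one copy of [z]. The fallback [(z, true)] also
   receives the components without a copy of [z], where the choice is immaterial. *)
pose k a := if conn g T op2 a (z, false) then (z, false) else (z, true).
pose h a := if a.1 \in A then a else k a.
have hA c : c.1 \in A -> h c = c by rewrite /h => ->.
have eqk c d : conn g T op2 c d -> k c = k d.
  move=> cd; rewrite /k; congr (if _ then _ else _).
  by apply/idP/idP; apply: conn_trans => //; rewrite conn_sym.
have hk x i : x \in B -> conn g (side_posts op2) op1 (h (x, i)) (k (x, i)).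
  move=> xB; rewrite /h; case: ifPn => /= xA; last exact: conn_refl.
  rewrite (capAB _ xA xB) /k; case: i => /=; last first.
    by rewrite conn_refl conn_refl.
  case: ifPn => z2; last exact: conn_refl.
  by apply: conn_post; rewrite /side_posts conn_sym z2 !inE eqxx.
rewrite -{2}(hA _ aA) -{2}(hA _ bA); apply: conn_hom => [|x xT|e i].
- exact: conn_sym.
- case: (boolP (x \in A)) => xA.
    by rewrite !hA //; apply/conn_post/sub_side_posts.
  rewrite /h /= (negPf xA) (eqk _ (x, true)); first exact: conn_refl.
  exact: conn_post.
- rewrite op12; case/orP=> o.
    by have /andP[? ?] := A1 _ _ o; rewrite !hA //; apply: conn_open.
  have /andP[xB yB] := B2 _ _ o.
  apply: conn_trans (hk _ _ xB) _; rewrite (eqk _ _ (conn_open g T o)).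
  by rewrite conn_sym; apply: hk.
Qed.

(** A walk from [A] to [B] must pass [z]. The layer [k] is one where it stands at [z] having used
    only the side [A] so far; its later excursions into [A] are summarised by [side_posts op1]. *)
Lemma conn_across (A B : {set V}) (op op1 op2 : E -> bool -> bool) :
  (forall x, (x \in A) || (x \in B)) ->
  (forall x, x \in A -> x \in B -> x = z) -> z \in B ->
  (forall e i, op e i = op1 e i || op2 e i) ->
  (forall e i, op1 e i -> ((g e).1 \in A) && ((g e).2 \in A)) ->
  (forall e i, op2 e i -> ((g e).1 \in B) && ((g e).2 \in B)) ->
  forall v i w j, v \in A -> w \in B ->
  conn g T op (v, i) (w, j) =
  [exists k, conn g T op1 (v, i) (z, k) &&
             conn g (side_posts op1) op2 (z, k) (w, j)].
Proof.
move=> AB capAB zB op12 A1 B2 v i w j vA wB.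
have sideB : forall a b, a.1 \in B -> b.1 \in B ->
    conn g T op a b = conn g (side_posts op1) op2 a b.
  apply: (@conn_side B A) => //; first by move=> x; rewrite orbC.
    by move=> x xB xA; apply: capAB.
  by move=> e k; rewrite op12 orbC.
apply/idP/existsP => [cvw|[k /andP[c1 c2]]]; last first.
  apply: (@conn_trans _ _ _ _ _ _ (z, k)); last by rewrite sideB.
  move: c1; apply: conn_sub => [x|e l o]; first exact: conn_post.
  by apply: conn_open; rewrite op12 o.
(* Invariant of the walk: it has passed a copy of [z] that is reached within the side [A], or it has
   not left that side. *)
pose P a := [exists k, conn g T op1 (v, i) (z, k) && conn g T op (z, k) a] ||
            (a.1 \in A) && conn g T op1 (v, i) a.
have : P (w, j).
  suff step a b : layers g T op a b -> P a -> P b.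
    by apply: (connect_invariant step cvw); rewrite /P /= vA conn_refl orbT.
  move=> ab /orP[/existsP[k /andP[c1 c2]]|/andP[aA c1]].
    apply/orP; left; apply/existsP; exists k; rewrite c1 /=.
    by apply: conn_trans c2 _; apply: connect1.
  case/orP: (ab) => [/andP[/eqP eab aT]|/existsP[e /and3P[/eqP el oe je]]].
    apply/orP; right; rewrite -eab aA; apply: conn_trans c1 _.
    by case: a b eab aT {ab aA} => [x k] [y l] /= <- xT; apply: conn_post.
  move: oe; rewrite op12 => /orP[] oe.
    have bA : b.1 \in A.
      by have /andP[] := A1 _ _ oe; case/ends_cases: je => ->.
    apply/orP; right; rewrite bA; apply: conn_trans c1 _.
    move: oe je; rewrite (surjective_pairing a) (surjective_pairing b) -el.
    exact: conn_edge.
  have aB : a.1 \in B.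
    by have /andP[] := B2 _ _ oe; case/ends_cases: je => ->.
  apply/orP; left; apply/existsP; exists a.2.
  by rewrite -(capAB _ aA aB) -surjective_pairing c1; apply: connect1.
case/orP=> [/existsP[k /andP[c1 c2]]|/andP[/= wA c1]].
  by exists k; rewrite c1 /= -sideB.
by exists j; rewrite (capAB _ wA wB) conn_refl andbT -(capAB _ wA wB).
Qed.

(** * Independence of the two sides *)

Local Open Scope ring_scope.

(** Exchanging two colourings outside [F1] is an involution on pairs. It turns [(c, d)] into a pair
    for which [H] reads [c] on both [F1] and [F2]. *)
Lemma sum_independent (F1 F2 : {set E})
    (H : {ffun E -> bool} -> {ffun E -> bool} -> int) :
  [disjoint F1 & F2] ->
  (forall c1 c2 d1 d2 : {ffun E -> bool}, {in F1, c1 =1 d1} -> {in F2, c2 =1 d2} ->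
    H c1 c2 = H d1 d2) ->
  (\sum_c H c c) *+ #|{ffun E -> bool}| = \sum_c \sum_d H c d.
Proof.
move=> dis HE; rewrite pair_bigA /=.
pose mix (p : {ffun E -> bool} * {ffun E -> bool}) : {ffun E -> bool} :=
  [ffun e => if e \in F1 then p.1 e else p.2 e].
pose f p := (mix p, mix (p.2, p.1)).
have fK : involutive f.
  by move=> [c d]; rewrite /f /=; congr (_, _); apply/ffunP => e;
    rewrite ffunE /=; case: ifP => h; rewrite ffunE /= h.
rewrite (reindex_inj (inv_inj fK)) /=.
transitivity (\sum_c \sum_(d : {ffun E -> bool}) H c c).
  by rewrite -sumrMnl; apply: eq_bigr => c _; rewrite sumr_const.
rewrite pair_bigA; apply: eq_bigr => -[c d] _ /=; apply: HE => e eF.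
  by rewrite ffunE eF.
by rewrite ffunE /= (disjointFl dis).
Qed.

Lemma sum_independent_ge0 (F1 F2 : {set E})
    (H : {ffun E -> bool} -> {ffun E -> bool} -> int) :
  [disjoint F1 & F2] ->
  (forall c1 c2 d1 d2 : {ffun E -> bool}, {in F1, c1 =1 d1} -> {in F2, c2 =1 d2} ->
    H c1 c2 = H d1 d2) ->
  0 <= \sum_c \sum_d H c d -> 0 <= \sum_c H c c.
Proof.
move=> dis HE; rewrite -(sum_independent dis HE) pmulrn_lge0 //.
by apply/card_gt0P; exists [ffun => true].
Qed.

Lemma eq_polar (F : {set E}) (c d : {ffun E -> bool}) :
  {in F, c =1 d} -> forall e i, polar F c e i = polar F d e i.
Proof. by move=> cd e i; rewrite /polar; case: (boolP (e \in F)) => // /cd ->. Qed.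

Variables (A B : {set V}) (F F1 F2 : {set E}).
Hypothesis AB : forall x, (x \in A) || (x \in B).
Hypothesis capAB : forall x, x \in A -> x \in B -> x = z.
Hypothesis zB : z \in B.
Hypothesis F12 : F = F1 :|: F2.
Hypothesis dis : [disjoint F1 & F2].
Hypothesis A1 : forall e, e \in F1 -> ((g e).1 \in A) && ((g e).2 \in A).
Hypothesis B2 : forall e, e \in F2 -> ((g e).1 \in B) && ((g e).2 \in B).

Let polar12 c e i : polar F c e i = polar F1 c e i || polar F2 c e i.
Proof. by rewrite /polar F12 inE andb_orl. Qed.

Let sideA c e i : polar F1 c e i -> ((g e).1 \in A) && ((g e).2 \in A).
Proof. by case/andP=> /A1. Qed.

Let sideB c e i : polar F2 c e i -> ((g e).1 \in B) && ((g e).2 \in B).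
Proof. by case/andP=> /B2. Qed.

(** Once the far side is coloured, [z] either acts as a post or does not, and the near total is
    nonnegative in both cases. *)
Lemma cut_same_side_ge0 v w : v \in A -> w \in A ->
  0 <= total_gap g T F1 v w -> 0 <= total_gap g (z |: T) F1 v w ->
  0 <= total_gap g T F v w.
Proof.
move=> vA wA h0 h1.
pose H c d := gap g (side_posts (polar F2 d)) (polar F1 c) v w.
have -> : total_gap g T F v w = \sum_c H c c.
  apply: eq_bigr => c _; rewrite /H /gap.
  by rewrite -!(conn_side AB capAB (polar12 c) (@sideA c) (@sideB c)).
apply: (sum_independent_ge0 dis).
  move=> c1 c2 d1 d2 e1 e2; rewrite /H /side_posts (eq_conn _ _ _ _ (eq_polar e2)).
  exact: (eq_gap _ _ _ _ (eq_polar e1)).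
rewrite exchange_big; apply: sumr_ge0 => d _.
by rewrite /H /side_posts; case: ifP.
Qed.

(** [H] distinguishes which copies of [z] are reached from [v] inside [A]. If both are, [z] acts as
    a post and the far total vanishes; if one is, the far gap appears with the sign of that copy; if
    none is, the gap is zero. Hence the double sum is the product of the two totals. *)
Lemma cut_across_ge0 v w : v \in A -> w \in B ->
  0 <= total_gap g T F1 v z -> 0 <= total_gap g T F2 z w ->
  0 <= total_gap g T F v w.
Proof.
move=> vA wB h1 h2.
pose X c k := conn g T (polar F1 c) (v, false) (z, k).
pose H c d : int := if X c false then
    if X c true then gap g (z |: T) (polar F2 d) z w else gap g T (polar F2 d) z w
  else if X c true then - gap g T (fun e i => polar F2 d e (~~ i)) z w else 0.
have -> : total_gap g T F v w = \sum_c H c c.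
  apply: eq_bigr => c _; rewrite /H {1}/gap.
  rewrite !(conn_across AB capAB zB (polar12 c) (@sideA c) (@sideB c)) //.
  have ex (P : pred bool) : [exists k, P k] = P false || P true.
    by apply/existsP/orP => [[[] ->]|[]]; [right|left|exists false|exists true].
  rewrite !ex -/(X c false) -/(X c true) /side_posts.
  case X0: (X c false); case X1: (X c true) => //=; rewrite ?orbF.
  - have -> : conn g T (polar F1 c) (z, false) (z, true).
      by apply: conn_trans X1; rewrite conn_sym.
    have vE l : conn g (z |: T) (polar F2 c) (z, true) (w, l) =
        conn g (z |: T) (polar F2 c) (z, false) (w, l).
      by apply/idP/idP; apply: conn_trans; apply: conn_post; rewrite !inE eqxx.
    by rewrite !vE !orbb.
  - case: ifP => // z1; move: X1; rewrite /X.
    by rewrite (conn_trans X0 z1).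
  - case: ifP => z1; last by rewrite gap_reflect opprB.
    by move: X0; rewrite /X (conn_trans X1) // conn_sym.
have Hneg (d : {ffun E -> bool}) : gap g T (fun e i => polar F2 d e (~~ i)) z w =
    gap g T (polar F2 (xorf d [ffun => true])) z w.
  by apply: eq_gap => e i; rewrite polar_neg.
apply: (sum_independent_ge0 dis).
  move=> c1 c2 d1 d2 e1 e2; rewrite /H /X !(eq_conn _ _ _ _ (eq_polar e1)).
  have e2' T' : gap g T' (polar F2 c2) z w = gap g T' (polar F2 d2) z w.
    exact: (eq_gap _ _ _ _ (eq_polar e2)).
  rewrite !e2'; do 2!case: ifP => // _; congr (- _).
  by apply: eq_gap => e i; rewrite (eq_polar e2).
suff -> : \sum_c \sum_d H c d = total_gap g T F1 v z * total_gap g T F2 z w.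
  exact: mulr_ge0.
rewrite /total_gap mulr_suml; apply: eq_bigr => c _; rewrite /H.
have -> : gap g T (polar F1 c) v z = (X c false)%:Z - (X c true)%:Z by [].
case: (X c false); case: (X c true) => /=.
- by rewrite subrr mul0r; apply: total_gap_post; rewrite !inE eqxx.
- by rewrite subr0 mul1r.
- rewrite sub0r mulN1r sumrN; congr (- _).
  rewrite [RHS](sum_xorf [ffun => true]); apply: eq_bigr => d _; exact: Hneg.
- by rewrite subrr mul0r big1.
Qed.

End CutVertex.

(** * At most four vertices *)

(* Vertices of the layered graph are encoded as pairs (index, layer), and the
   components are computed by merging labels along a list of links. *)
Definition node := (nat * bool)%type.

Definition glue (lab : node -> nat) (p : node * node) : node -> nat :=
  let a := lab p.1 in let b := lab p.2 in
  fun x => let l := lab x in if l == b then a else l.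

Definition labels (L : seq (node * node)) : node -> nat :=
  foldl glue (fun x => x.2 + x.1.*2) L.

Lemma glue_eq lab p x y : lab x = lab y -> glue lab p x = glue lab p y.
Proof. by rewrite /glue => ->. Qed.

Lemma labels_complete (L : seq (node * node)) p :
  p \in L -> labels L p.1 = labels L p.2.
Proof.
rewrite /labels; move: (fun x : node => _) => lab.
have keep L' lab' x y : lab' x = lab' y -> foldl glue lab' L' x = foldl glue lab' L' y.
  by elim: L' lab' => //= q L' IH lab' h; apply: IH; apply: glue_eq.
elim: L lab => //= q L IH lab; rewrite inE => /orP[/eqP->|/IH] //.
by apply: keep; rewrite /glue eqxx; case: eqP.
Qed.

(** The initial labels [2n + i] are injective, and classes are merged only along a link, so equal
    labels always mean connected images. *)
Lemma labels_sound (B : finType) (r : rel B) (k : node -> B)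
    (L : seq (node * node)) :
  connect_sym r -> (forall p, p \in L -> connect r (k p.1) (k p.2)) ->
  forall x y, labels L x = labels L y -> connect r (k x) (k y).
Proof.
move=> rS hL; rewrite /labels; set lab := (fun x : node => _).
have : forall x y, lab x = lab y -> connect r (k x) (k y).
  move=> [n i] [m j]; rewrite /lab /= => e.
  suff [-> ->] : n = m /\ i = j by rewrite connect0.
  by move: e; case: i; case: j => /=; lia.
elim: L lab hL => //= q L IH lab hL hlab x y.
apply: IH => [p pL|{}x {}y]; first by apply: hL; rewrite inE pL orbT.
have hq : connect r (k q.1) (k q.2) by apply: hL; rewrite inE eqxx.
rewrite /glue; case: eqP => xq; case: eqP => yq h.
- by apply: connect_trans (hlab _ _ xq) _; rewrite rS; apply: hlab.
- apply: connect_trans (hlab _ _ xq) _; rewrite rS in hq.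
  by apply: connect_trans hq _; apply: hlab.
- apply: connect_trans (hlab _ _ h) _; apply: connect_trans hq _.
  by rewrite rS; apply: hlab.
- exact: hlab.
Qed.

Fixpoint colourings n : seq bitseq :=
  if n is n'.+1 then
    map (cons true) (colourings n') ++ map (cons false) (colourings n')
  else [:: [::]].

Lemma mem_colourings (bs : bitseq) : bs \in colourings (size bs).
Proof.
elim: bs => //= b bs IH; rewrite mem_cat; apply/orP.
by case: b; [left|right]; apply: map_f.
Qed.

Definition links (ps : seq (nat * nat)) (ts : seq nat) (bs : bitseq) :=
  [seq ((n, false), (n, true)) | n <- ts] ++
  [seq ((q.1.1, q.2), (q.1.2, q.2)) | q <- zip ps bs].

Definition linked ps ts j bs :=
  let lab := labels (links ps ts bs) in lab (0, false) == lab (1, j).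

Definition pairs4 := [:: (0, 1); (0, 2); (0, 3); (1, 2); (1, 3); (2, 3)].

Lemma mem_pairs4 n m : n < m -> m < 4 -> (n, m) \in pairs4.
Proof. by case: m => [|[|[|[|m]]]] //; case: n => [|[|[|n]]]. Qed.

Definition favourable ps ts :=
  count (linked ps ts true) (colourings (size ps)) <=
  count (linked ps ts false) (colourings (size ps)).

(** Nodes 0 and 1 stand for [v] and [w], which carry no post. This leaves 64 edge sets and 4 post
    sets, each selected by a mask, and all of them are evaluated. *)
Lemma favourable_pairs4 m k : size m = 6 -> size k = 2 ->
  favourable (mask m pairs4) (mask k [:: 2; 3]).
Proof.
have h : all (fun m => all (fun k => favourable (mask m pairs4) (mask k [:: 2; 3]))
    (colourings 2)) (colourings 6) by vm_compute.
move=> sm sk; have := mem_colourings m; rewrite sm => /(allP h)/allP; apply.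
by rewrite -sk mem_colourings.
Qed.

Section SmallGraphs.
Local Open Scope ring_scope.

(** Every colouring of the list [es] extends to equally many colourings of [E]; multiples on both
    sides avoid a division. *)
Lemma sum_colourings (E : finType) (es : seq E) (H : bitseq -> int) : uniq es ->
  (\sum_(c : {ffun E -> bool}) H [seq c e | e <- es]) *+ 2 ^ size es =
  (\sum_(bs <- colourings (size es)) H bs) *+ #|{ffun E -> bool}|.
Proof.
elim: es H => [|e es IH] H /=; first by rewrite sumr_const big_seq1.
case/andP=> ne /IH{}IH; rewrite big_cat !big_map mulrnDl -!IH -mulrnDl.
rewrite expnS mulrnA; congr (_ *+ _).
rewrite mulr2n {2}(sum_xorf [ffun e' => e' == e]) -!big_split /=.
apply: eq_bigr => c _.
have -> : [seq (xorf c [ffun e' => e' == e]) i | i <- es] = [seq c i | i <- es].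
  apply/eq_in_map => f fe; rewrite !ffunE.
  by case: eqP fe ne => [-> ->|]; rewrite ?addbF.
by rewrite !ffunE eqxx; case: (c e); rewrite //= addrC.
Qed.

Lemma sum_count (X : Type) (s : seq X) (P Q : pred X) :
  \sum_(x <- s) ((P x)%:Z - (Q x)%:Z) = (count P s)%:Z - (count Q s)%:Z.
Proof.
elim: s => [|x s IH]; first by rewrite big_nil.
by rewrite big_cons IH /=; lia.
Qed.

(** Vertices are numbered by their position in [v, w, s]. Since there are no parallel edges or
    loops, an edge amounts to a pair of numbers, and connectivity becomes equality of computed
    labels. *)
Lemma small_ge0 (V E : finType) (g : E -> V * V) (T : {set V}) (F : {set E})
    (v w : V) (s : seq V) :
  uniq [:: v, w & s] -> (size s <= 2)%N ->
  (forall e, e \in F -> [&& (g e).1 \in [:: v, w & s], (g e).2 \in [:: v, w & s]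
                          & (g e).1 != (g e).2]) ->
  (forall e e' x y, e \in F -> e' \in F -> joins g e x y -> joins g e' x y ->
    e = e') ->
  0 <= total_gap g T F v w.
Proof.
set S := [:: v, w & s]; have SE : S = [:: v, w & s] by [].
clearbody S => uS ss FS simple.
have [vS wS] : v \in S /\ w \in S by rewrite SE !inE !eqxx orbT.
have [iv iw] : index v S = 0%N /\ index w S = 1%N.
  by move: uS; rewrite SE /= inE negb_or !eqxx => /andP[/andP[/negPf-> _] _].
case: (boolP (v \in T)) => vT; first by rewrite total_gap_post.
case: (boolP (w \in T)) => wT; first by rewrite total_gapC total_gap_post.
pose em (p : nat * nat) := [pick e in F | joins g e (nth v S p.1) (nth v S p.2)].
pose ps := [seq p <- pairs4 | (p.2 < size S)%N && em p].
pose ts := [seq n <- [:: 2; 3]%N | (n < size S)%N && (nth v S n \in T)].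
pose es := pmap em ps.
have emP p e : em p = Some e -> e \in F /\ joins g e (nth v S p.1) (nth v S p.2).
  by rewrite /em; case: pickP => // e' /andP[? ?] [<-].
have emE e n m : e \in F -> joins g e (nth v S n) (nth v S m) -> em (n, m) = Some e.
  move=> eF je; rewrite /em; case: pickP => [e' /andP[e'F je']|/(_ e)].
    by rewrite (simple _ _ _ _ e'F eF je' je).
  by rewrite eF je.
have psem p : p \in ps -> [/\ (p.1 < p.2)%N, (p.2 < size S)%N & em p].
  rewrite mem_filter => /andP[/andP[h1 h2] h3]; split=> //.
  by move: h3; rewrite !inE; do !case/orP; move=> /eqP ->.
have ues : uniq es.
  (* The ordered positions of the ends recover the pair from its edge, so distinct pairs give
     distinct edges. *)
  pose k e := (minn (index (g e).1 S) (index (g e).2 S),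
               maxn (index (g e).1 S) (index (g e).2 S)).
  apply: (@map_uniq _ _ k); suff kes l : {subset l <= ps} -> map k (pmap em l) = l.
    by rewrite kes // filter_uniq.
  elim: l => //= p l IH hl.
  have [h1 h2] : [/\ (p.1 < p.2)%N, (p.2 < size S)%N & em p].
    by apply/psem/hl; rewrite inE eqxx.
  case ep: (em p) => [e|] // _ /=; rewrite IH; last first.
    by move=> q ql; apply: hl; rewrite inE ql orbT.
  have [_ je] := emP _ _ ep; have h3 := ltn_trans h1 h2.
  congr cons; rewrite /k; case/ends_cases: je => -> /=; rewrite !index_uniq //.
    by case: p h1 {hl h2 ep h3} => a b /= h; rewrite /minn /maxn h.
  by case: p h1 {hl h2 ep h3} => a b /= h; rewrite minnC maxnC /minn /maxn h.
have zipE (c : E -> bool) : zip ps [seq c e | e <- es] =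
    pmap (fun p => omap (fun e => (p, c e)) (em p)) ps.
  suff zipl l : {subset l <= ps} -> zip l [seq c e | e <- pmap em l] =
      pmap (fun p => omap (fun e => (p, c e)) (em p)) l by exact: zipl.
  elim: l => //= p l IH hl.
  have [_ _] : [/\ (p.1 < p.2)%N, (p.2 < size S)%N & em p].
    by apply/psem/hl; rewrite inE eqxx.
  case: (em p) => //= e _; congr cons; apply: IH => q ql.
  by apply: hl; rewrite inE ql orbT.
pose L (c : {ffun E -> bool}) := links ps ts [seq c e | e <- es].
have mem_L (c : {ffun E -> bool}) p e : p \in ps -> em p = Some e ->
    ((p.1, c e), (p.2, c e)) \in L c.
  move=> pp ep; rewrite mem_cat; apply/orP; right; rewrite zipE.
  apply/mapP; exists (p, c e) => //.
  by rewrite mem_pmap; apply/mapP; exists p; rewrite // ep.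
have connE c j : conn g T (polar F c) (v, false) (w, j) =
    linked ps ts j [seq c e | e <- es].
  apply/idP/eqP => [cvw|].
    pose P (a : V * bool) := (a.1 \in S) &&
      (labels (L c) (0, false)%N == labels (L c) (index a.1 S, a.2)).
    suff step a b : layers g T (polar F c) a b -> P a -> P b.
      have := connect_invariant step cvw; rewrite /P /= vS wS iv iw eqxx.
      by move=> /(_ isT)/eqP.
    case: a b => [x i] [y k] st /andP[/= xS /eqP lx].
    case/orP: st => [/= /andP[/eqP <- xT]|/existsP[e /and3P[/= /eqP<- oe je]]].
      rewrite /P /= xS lx; have xL : ((index x S, false), (index x S, true)) \in L c.
        rewrite mem_cat; apply/orP; left.
        apply: (map_f (fun n : nat => ((n, false), (n, true)))); rewrite mem_filter.
        rewrite index_mem xS nth_index // xT.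
        have : (index x S < 4)%N by apply: leq_trans (_ : size S <= 4)%N; rewrite ?index_mem // SE.
        rewrite SE /=; case: eqP => [vx|_]; first by rewrite vx xT in vT.
        case: eqP => [wx|_]; first by rewrite wx xT in wT.
        by case: (index x s) => [|[|]].
      have /= := labels_complete xL.
      by move=> h; case: (i); case: (k); rewrite ?h.
    case/andP: oe => eF /eqP ci; have /and3P[e1 e2 ne] := FS e eF.
    have [yS nxy] : y \in S /\ x != y.
      by case/ends_cases: je e1 e2 ne => -> /= h1 h2 h3; split; rewrite // eq_sym.
    rewrite /P /= yS lx.
    have pairE n m : (n < m < size S)%N -> (n, m) \in pairs4.
      by case/andP=> nm mS; apply: mem_pairs4 nm (leq_trans mS _); rewrite SE.
    have nI : index x S != index y S.
      by apply: contraNneq nxy => h; rewrite -(nth_index v xS) h nth_index.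
    case: (ltngtP (index x S) (index y S)) nI => // lt _.
      have ep : em (index x S, index y S) = Some e.
        by apply: emE; rewrite ?nth_index.
      have pp : (index x S, index y S) \in ps.
        by rewrite mem_filter ep pairE /= ?index_mem ?yS // lt.
      by have /= := labels_complete (mem_L c _ _ pp ep); rewrite ci => ->.
    have ep : em (index y S, index x S) = Some e.
      by apply: emE; rewrite ?nth_index // joinsC.
    have pp : (index y S, index x S) \in ps.
      by rewrite mem_filter ep pairE /= ?index_mem ?xS // lt.
    by have /= := labels_complete (mem_L c _ _ pp ep); rewrite ci => ->.
  pose k (a : node) := (nth v S a.1, a.2).
  have kvw : (v, false) = k (0, false)%N /\ (w, j) = k (1, j)%N by rewrite /k SE.
  rewrite kvw.1 kvw.2; apply: labels_sound; first exact: conn_sym.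
  move=> p; rewrite mem_cat => /orP[/mapP[n]|].
    rewrite mem_filter => /andP[/andP[_ nT] _] -> /=; exact: conn_post.
  rewrite zipE => /mapP[q]; rewrite mem_pmap => /mapP[r rp].
  case er: (em r) => [e|] //= [->] -> /=.
  by have [eF je] := emP _ _ er; apply: conn_edge je; rewrite /polar eF /=.
pose H bs : int := (linked ps ts false bs)%:Z - (linked ps ts true bs)%:Z.
have -> : total_gap g T F v w = \sum_(c : {ffun E -> bool}) H [seq c e | e <- es].
  by apply: eq_bigr => c _; rewrite /H /gap !connE.
rewrite -(@pmulrn_lge0 _ _ (2 ^ size es)) ?expn_gt0 // sum_colourings //.
apply: mulrn_wge0; rewrite /H sum_count subr_ge0 lez_nat.
have -> : size es = size ps.
  rewrite /es size_pmap; apply/eqP.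
  by rewrite -all_count; apply/allP => p /psem[].
(* Filtering a list is masking it, which brings the given graph under the computed cases. *)
have := @favourable_pairs4 [seq (p.2 < size S)%N && em p | p <- pairs4]
  [seq (n < size S)%N && (nth v S n \in T) | n <- [:: 2; 3]%N] erefl erefl.
by rewrite -!filter_mask.
Qed.

End SmallGraphs.

(** * Minors from branch sets *)

Definition inside (V : finType) (H : eqType) (r : rel V) (f : V -> option H) :
  rel V := fun x y => r x y && (f x == f y).

(* The branch set of h is the preimage of Some h. Branch sets of isolated
   vertices of H may be empty. *)
Definition has_model (V : finType) (r : rel V) (H : sgraph) : Prop :=
  exists f : V -> option H,
    (forall x y h, f x = Some h -> f y = Some h -> connect (inside r f) x y) /\
    (forall h h', adj h h' -> exists x y, [/\ f x = Some h, f y = Some h' & r x y]).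

Lemma inside_sym (V : finType) (H : eqType) (r : rel V) (f : V -> option H) :
  symmetric r -> connect_sym (inside r f).
Proof.
by move=> rS; apply: sym_connect_sym => x y; rewrite /inside rS eq_sym.
Qed.

Lemma model_sub (V : finType) (r r' : rel V) (H : sgraph) :
  subrel r r' -> has_model r H -> has_model r' H.
Proof.
move=> rr' [f [fc fa]]; exists f; split=> [x y h fx fy|h h' /fa[x [y [fx fy xy]]]].
  apply: connect_sub (fc _ _ _ fx fy) => a b /andP[ab fab].
  by apply: connect1; rewrite /inside rr'.
by exists x, y; split=> //; apply: rr'.
Qed.

Lemma identify_same (V : finType) (x y : V) : identify x y x = x.
Proof. by rewrite /identify; case: eqP. Qed.

(** The vertex [y] joins the branch set of [x], to which it is adjacent, and [lift] turns each edge
    of [r'] into an edge of [r] between preimages. *)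
Lemma model_contract (V : finType) (r r' : rel V) (x y : V) (H : sgraph) :
  symmetric r -> r x y ->
  (forall a b, r' a b -> exists u v, [/\ identify x y u = a, identify x y v = b & r u v]) ->
  has_model r' H -> has_model r H.
Proof.
move=> rS xy lift [f [fc fa]]; pose m := identify x y.
exists (f \o m); split=> [a b h /= fa' fb|h h' /fa[a [b [fah fbh /lift]]]].
  have mconn u : connect (inside r (f \o m)) u (m u).
    rewrite /m {2}/identify; case: eqP => [->|_]; last exact: connect0.
    by apply: connect1; rewrite /inside rS xy /= /m identify_same /identify eqxx.
  apply: connect_trans (mconn a) _; rewrite inside_sym //.
  apply: connect_trans (mconn b) _; rewrite inside_sym //.
  apply: (@connect_hom _ _ (inside r' f) _ id) (fc _ _ _ fa' fb) => p q /andP[/lift].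
  move=> [u [v [<- <- uv]]] fuv; rewrite inside_sym //.
  apply: connect_trans (_ : connect _ v _); first by rewrite inside_sym //; apply: mconn.
  rewrite inside_sym //; apply: connect_trans (_ : connect _ u _).
    by rewrite inside_sym //; apply: mconn.
  by apply: connect1; rewrite /inside uv /=.
by move=> [u [v [ua vb uv]]]; exists u, v; rewrite /= /m ua vb.
Qed.

(** Branch sets compose: the branch sets in [V] belonging to one branch set in [H] are united, and
    the edges of [H] keep the union connected. *)
Lemma model_trans (V : finType) (r : rel V) (H K : sgraph) :
  has_model r H -> has_model (@adj H) K -> has_model r K.
Proof.
move=> [f [fc fa]] [k [kc ka]]; pose fk x := obind k (f x).
have sub x y : connect (inside r f) x y -> connect (inside r fk) x y.
  apply: connect_sub => a b /andP[ab /eqP fab].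
  by apply: connect1; rewrite /inside ab /fk fab /=.
exists fk; split=> [x y z|z z' /ka[h [h' [kh kh' /fa[x [y [fx fy xy]]]]]]]; last first.
  by exists x, y; rewrite /fk fx fy.
rewrite /fk; case fx: (f x) => [h|] //=; case fy: (f y) => [h'|] //= kh kh'.
have /connectP[p] := kc _ _ _ kh kh'.
elim: p h x fx kh => [|h1 p IH] h x fx kh /=.
  by move=> _ e; apply/sub/(fc _ _ h); rewrite // -e.
case/andP=> /andP[/fa[u [u1 [fu fu1 uu1]]] /eqP kk] hp hl.
apply: connect_trans (sub _ _ (fc _ _ _ fx fu)) _.
apply: connect_trans (_ : connect _ u u1) _.
  by apply: connect1; rewrite /inside uu1 /fk fu fu1 /= kk.
by apply: IH fu1 _ hp hl; rewrite -kk.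
Qed.

Lemma model_minor (G H : sgraph) :
  (forall h : H, exists h', adj h h') -> has_model (@adj G) H -> has_minor G H.
Proof.
move=> niso; have [n] := ubnP #|G|; elim: n G => // n IHn G ltn.
have [k] := ubnP #|[set u : G * G | adj u.1 u.2]|.
elim: k G ltn => // k IHk G ltn ltk [f [fc fa]].
have smaller (y : G) : (#|{: {v : G | v != y}}| < n)%N.
  have := max_card (pred1 y); rewrite card1 => G0.
  rewrite card_sig -ltnS; apply: leq_trans ltn; rewrite ltnS.
  by rewrite (eq_card (B := predC1 y)) // cardC1 prednK.
case: (boolP [exists u : G * G, adj u.1 u.2 && (f u.1 == f u.2) && (f u.1 : bool)]).
  case/existsP=> -[x y] /= /andP[/andP[xy /eqP fxy] fx]; apply: (minor_contract xy).
  have nxy : x != y by apply: contraTneq xy => ->; rewrite adj_irr.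
  apply: IHn; first exact: smaller.
  exists (fun u => f (val u)).
  pose q (u : G) : contract x y := insubd (Sub x nxy) u.
  have vq u : val (q u) = identify x y u.
    by rewrite val_insubd /identify; case: eqP.
  have fq u : f (val (q u)) = f u.
    by rewrite vq /identify; case: eqP => // ->.
  have qadj u v : adj u v -> q u != q v -> adj (q u) (q v).
    move=> uv nq; rewrite /= /contract_rel nq !vq /identify.
    case: (eqVneq u y) uv nq => [->|_] uv nq.
      case: (eqVneq v y) uv nq => [->|_] uv nq; first by rewrite adj_irr in uv.
      by rewrite eqxx uv orbT.
    case: (eqVneq v y) uv nq => [->|_] uv nq; last by rewrite uv.
    by rewrite eqxx uv !orbT.
  have qv (u : contract x y) : q (val u) = u by rewrite /q valKd.
  split=> [u v h fu fv|h h' hh'].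
    rewrite -(qv u) -(qv v).
    apply: (connect_hom (h := q) _ (fc _ _ _ fu fv)) => a b /andP[ab fab].
    case: (eqVneq (q a) (q b)) => [->|ne]; first exact: connect0.
    by apply: connect1; rewrite /inside qadj //= !fq.
  have [u [v [fu fv uv]]] := fa _ _ hh'.
  exists (q u), (q v); rewrite !fq; split=> //; apply: qadj => //.
  apply/eqP => e; have := fq u; rewrite e fq fu fv => -[hE].
  by rewrite hE adj_irr in hh'.
rewrite negb_exists => /forallP noin.
have sing x y h : f x = Some h -> f y = Some h -> x = y.
  move=> fx fy; have /connectP[[|u p] /=] := fc _ _ _ fx fy; first by move=> _ ->.
  case/andP=> /andP[xu fxu] _ _; have := noin (x, u).
  by rewrite /= xu fxu fx.
pose good (u : G * G) := if (f u.1, f u.2) is (Some h, Some h') then adj h h' else false.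
case: (boolP [exists u : G * G, adj u.1 u.2 && ~~ good u]).
  case/existsP=> -[x y] /= /andP[xy ngood]; apply: (minor_del_edge xy).
  apply: IHk => //.
    apply: leq_trans (_ : _ < #|[set u : G * G | adj u.1 u.2]|)%N ltk; rewrite ?ltnS //.
    apply: proper_card; apply/properP; split.
      by apply/subsetP => u; rewrite !inE => /andP[].
    by exists (x, y); rewrite !inE //= /del_edge_rel eqxx andbF.
  exists f; split=> [u v h fu fv|h h' hh'].
    by rewrite (sing _ _ _ fu fv); apply: connect0.
  have [u [v [fu fv uv]]] := fa _ _ hh'; exists u, v; split=> //.
  rewrite /= /del_edge_rel uv /= eq_pair_set; apply/negP.
  by case/orP=> /andP[/eqP ux /eqP vy]; move: ngood; rewrite /good /= -ux -vy fu fv ?hh' // adj_sym hh'.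
rewrite negb_exists => /forallP allgood.
have good_adj u v : adj u v -> good (u, v).
  by move=> uv; have := allgood (u, v); rewrite /= uv /= negbK.
case: (boolP [exists x, ~~ (f x : bool)]).
  case/existsP=> x fx; apply: (@minor_del_vertex _ _ x).
    by move=> v; apply/negP => /good_adj; rewrite /good /=; case: (f x) fx.
  apply: IHn; first exact: smaller.
  exists (fun u => f (val u)).
  split=> [u v h fu fv|h h' /fa[u [v [fu fv uv]]]].
    by rewrite (val_inj (sing _ _ _ fu fv)); apply: connect0.
  have nx w h1 : f w = Some h1 -> w != x.
    by move=> fw; apply: contraNneq fx => <-; rewrite fw.
  by exists (Sub u (nx _ _ fu)), (Sub v (nx _ _ fv)).
rewrite negb_exists => /forallP full; apply: minor_iso.
have ex x : {h | f x = Some h}.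
  by case fx: (f x) => [h|]; [exists h | have := full x; rewrite fx].
have [k' fE] : {k' : G -> H | forall x, f x = Some (k' x)}.
  by exists (fun x => sval (ex x)) => x; apply: (svalP (ex x)).
have pre h : exists x, f x == Some h.
  by have [h' /fa[x [_ [fx _ _]]]] := niso h; exists x; rewrite fx.
exists k'.
  exists (fun h => xchoose (pre h)) => [x|h].
    by apply: sing (fE x); apply/eqP/(xchooseP (pre _)).
  by apply: Some_inj; rewrite -fE; apply/eqP/(xchooseP (pre h)).
move=> x y; apply/idP/idP => [/fa[u [v [fu fv]]]|/good_adj].
  by rewrite (sing _ _ _ fu (fE x)) (sing _ _ _ fv (fE y)).
by rewrite /good /= !fE.
Qed.

(** * Two-connected graphs with five vertices *)

Lemma uniq_flatten_nth (T : eqType) (ss : seq (seq T)) i j x :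
  uniq (flatten ss) -> x \in nth [::] ss i -> x \in nth [::] ss j -> i = j.
Proof.
have memf (l : seq (seq T)) n : x \in nth [::] l n -> x \in flatten l.
  move=> xl; apply/flattenP; exists (nth [::] l n) => //.
  by apply: mem_nth; rewrite ltnNge; apply: contraL xl => h; rewrite nth_default.
elim: ss i j => [|s ss IH] [|i] [|j] //=; rewrite cat_uniq => /and3P[_ dis us].
- by move=> xs /memf xss; case/hasP: dis; exists x.
- by move=> /memf xss xs; case/hasP: dis; exists x.
- by move=> h1 h2; rewrite (IH i j).
Qed.

Lemma perm_theta (T : eqType) (x y : T) p q s :
  perm_eq (x :: y :: p ++ q ++ s) (s ++ x :: p ++ y :: q).
Proof.
rewrite perm_sym perm_catC /= perm_cons -catA /=.
by rewrite -(cat1s y (q ++ s)) perm_catCA.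
Qed.

Lemma perm_chord (T : eqType) (u x a : T) p q :
  perm_eq (u :: p ++ x :: q ++ [:: a]) (u :: (a :: q) ++ x :: p).
Proof.
apply/permP => t; rewrite /= !count_cat /= count_cat /=.
by move: (count t p) (count t q) => i j; lia.
Qed.

Section Structure.
Variables (V : finType) (r : rel V).
Hypothesis rS : symmetric r.
Hypothesis rI : irreflexive r.

Definition touch (s t : seq V) := exists x y, [/\ x \in s, y \in t & r x y].

Lemma touchC s t : touch s t -> touch t s.
Proof. by case=> x [y [xs yt xy]]; exists y, x; rewrite rS. Qed.

(** A path connects its own vertices, so disjoint paths serve as branch sets; [ix h] is the position
    of the path for [h]. *)
Lemma model_of_paths (H : sgraph) (ix : H -> nat) (ss : seq (seq V)) :
  injective ix -> uniq (flatten ss) -> all (sorted r) ss ->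
  (forall h h', adj h h' -> touch (nth [::] ss (ix h)) (nth [::] ss (ix h'))) ->
  has_model r H.
Proof.
move=> ixI us sorts ta; pose f x := [pick h | x \in nth [::] ss (ix h)].
have fE x h : x \in nth [::] ss (ix h) -> f x = Some h.
  move=> xh; rewrite /f; case: pickP => [h' xh'|/(_ h)]; last by rewrite xh.
  by rewrite (ixI _ _ (uniq_flatten_nth us xh' xh)).
have fI x h : f x = Some h -> x \in nth [::] ss (ix h).
  by rewrite /f; case: pickP => // h' xh' [<-].
exists f; split=> [x y h /fI xh /fI yh|h h' /ta[x [y [/fE xh /fE yh xy]]]].
  have : sorted r (nth [::] ss (ix h)).
    by apply: (allP sorts); apply: mem_nth; rewrite ltnNge;
      apply: contraL xh => k; rewrite nth_default.
  case: (nth _ _ _) xh yh (fE^~ h) => // z p xh yh {}fE zp.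
  have conn_z t : t \in z :: p -> connect (inside r f) z t.
    move=> tp; case/splitPl: tp zp fE => p1 p2 <- zp fE; apply/connectP; exists p1 => //.
    move: zp; rewrite /= cat_path => /andP[+ _].
    have {fE}: all (fun t => f t == Some h) (z :: p1).
      by apply/allP => t1 tz; apply/eqP/fE; rewrite -cat_cons mem_cat tz.
    elim: p1 z {xh yh} => //= t' p1 IH z /and3P[/eqP fz ft ap] /andP[zt t'p].
    by rewrite /inside zt fz (eqP ft) eqxx /= IH //= ft.
  apply: connect_trans (conn_z _ yh); rewrite inside_sym //; exact: conn_z.
by exists x, y.
Qed.

Lemma C5_chord_model s0 s1 s2 s3 s4 :
  uniq (flatten [:: s0; s1; s2; s3; s4]) ->
  all (sorted r) [:: s0; s1; s2; s3; s4] ->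
  touch s0 s1 -> touch s1 s2 -> touch s2 s3 -> touch s3 s4 -> touch s4 s0 ->
  touch s0 s2 -> has_model r C5_chord.
Proof.
move=> us sorts t01 t12 t23 t34 t40 t02.
apply: (@model_of_paths C5_chord (@nat_of_ord 5) _ _ us sorts); first exact: ord_inj.
move=> [[|[|[|[|[|i]]]]] // ?] [[|[|[|[|[|j]]]]] // ?];
rewrite /= /add_edge_rel ?eq_pair_set /= /cycle_rel -?val_eqE /= ?inordK //= => _;
by [|apply: touchC].
Qed.

Lemma K23_model s0 s1 s2 s3 s4 :
  uniq (flatten [:: s0; s1; s2; s3; s4]) ->
  all (sorted r) [:: s0; s1; s2; s3; s4] ->
  touch s0 s2 -> touch s0 s3 -> touch s0 s4 ->
  touch s1 s2 -> touch s1 s3 -> touch s1 s4 -> has_model r K23.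
Proof.
move=> us sorts t02 t03 t04 t12 t13 t14.
pose ix (i : 'I_2 + 'I_3) : nat := match i with inl i => i | inr j => j.+2 end.
apply: (@model_of_paths K23 ix _ _ us sorts).
  move=> [i|i] [j|j] //=; rewrite /ix.
  - by move/ord_inj->.
  - by have := ltn_ord i; lia.
  - by have := ltn_ord j; lia.
  - by case=> /ord_inj->.
move=> [[[|[|i]] // ?]|[[|[|[|i]]] // ?]] [[[|[|j]] // ?]|[[|[|[|j]]] // ?]] //= _;
by [|apply: touchC].
Qed.

(** * Ears and chords of a longest cycle *)

Definition outside (c : seq V) : rel V :=
  fun x y => [&& r x y, x \notin c & y \notin c].

Definition avoiding (z : V) : rel V := fun x y => [&& r x y, x != z & y != z].

Lemma outside_sym c : connect_sym (outside c).
Proof. by apply: sym_connect_sym => x y; rewrite /outside rS andbC [in RHS]andbC -!andbA; do !bool_congr. Qed.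

Lemma outside_path c k1 k2 : k1 \notin c -> connect (outside c) k1 k2 ->
  exists q, [/\ path r k1 q, last k1 q = k2, uniq (k1 :: q) &
             {in k1 :: q, forall x, x \notin c}].
Proof.
move=> k1c /connectP[q0 hq0 ->]; case/shortenP: hq0 => q hq uq _.
exists q; split=> //.
  by apply: sub_path hq => x y /andP[].
elim: q k1 k1c hq {uq} => [|k q IH] k1 k1c /=; first by move=> _ x; rewrite inE => /eqP->.
case/andP=> /and3P[_ _ kc] kq x; rewrite inE => /orP[/eqP->//|]; exact: IH.
Qed.

Section LongestCycle.
Variable n : nat.
Hypothesis longest : forall c, cycle r c -> uniq c -> size c <= n.

(** Replacing the edge [xy] of the cycle by a detour through [k1] and [k2] would give a longer
    cycle. *)
Lemma no_detour x y p k1 k2 :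
  cycle r [:: x, y & p] -> uniq [:: x, y & p] -> size [:: x, y & p] = n ->
  r x k1 -> r y k2 -> k1 \notin [:: x, y & p] ->
  connect (outside [:: x, y & p]) k1 k2 -> False.
Proof.
move=> cyc uc sc xk1 yk2 k1c /(outside_path k1c)[q [pq lq uq oq]].
have : size (x :: (k1 :: q) ++ y :: p) <= n.
  apply: longest.
    move: cyc; rewrite /= => /andP[xy py]; rewrite xk1 rcons_cat cat_path pq lq /= rS yk2.
    by rewrite py.
  move: uc; rewrite cons_uniq => /andP[xn uyp].
  rewrite cons_uniq mem_cat negb_or xn andbT cat_uniq uq uyp andbT.
  apply/andP; split; first by apply/negP => /oq; rewrite inE eqxx.
  apply/hasPn => t tp; apply/negP => /oq; rewrite inE tp orbT.
  by [].
by move: sc; rewrite /= size_cat /=; lia.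
Qed.

(** By [no_detour] the ends of the ear are not consecutive, so both arcs have inner vertices. The
    interiors of the two arcs and of the ear are the three branch sets joined to both [x] and
    [y]. *)
Lemma ear_model c x y k1 k2 :
  cycle r c -> uniq c -> size c = n -> x \in c -> y \in c -> x != y ->
  r x k1 -> r y k2 -> k1 \notin c -> connect (outside c) k1 k2 ->
  has_model r K23.
Proof.
move=> cyc uc sc xc yc nxy xk1 yk2 k1c con.
have [i s cE] := rot_to xc.
have memE : c =i x :: s by move=> t; rewrite -cE mem_rot.
have {}con : connect (outside (x :: s)) k1 k2.
  by apply: connect_sub con => a b /and3P[ab ac bc]; apply: connect1; rewrite /outside ab -!memE ac.
rewrite memE in k1c; rewrite memE inE eq_sym (negPf nxy) /= in yc.
have {}cyc : cycle r (x :: s) by rewrite -cE rot_cycle.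
have {}uc : uniq (x :: s) by rewrite -cE rot_uniq.
have {}sc : size (x :: s) = n by rewrite -cE size_rot.
clear cE memE xc.
case/splitPr: yc cyc uc sc k1c con => p1 p2 cyc uc sc k1c con.
case: p1 cyc uc sc k1c con => [|a1 p1] cyc uc sc k1c con; first by case: (no_detour cyc uc sc xk1 yk2).
case: p2 cyc uc sc k1c con => [|b1 p2] cyc uc sc k1c con.
  (* Here [y] comes last on the cycle, so it is again next to [x]: the cycle is rotated to start
     with [y, x] and the ear is run backwards. *)
  have rE : rot (size (x :: a1 :: p1)) (x :: (a1 :: p1) ++ [:: y]) = [:: y, x, a1 & p1].
    by rewrite -cat_cons rot_size_cat.
  have mE t : (t \in x :: (a1 :: p1) ++ [:: y]) = (t \in [:: y, x, a1 & p1]).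
    by rewrite -rE mem_rot.
  have k2c : k2 \notin [:: y, x, a1 & p1].
    rewrite -mE; have [q [_ <- _ ]] := outside_path k1c con; apply; exact: mem_last.
  case: (@no_detour y x (a1 :: p1) k2 k1); rewrite -?rE ?rot_cycle ?rot_uniq ?size_rot //.
    by rewrite mem_rot mE.
  rewrite outside_sym; apply: connect_sub con => a b /and3P[ab ac bc].
  by apply: connect1; rewrite /outside ab rE -!mE ac.
have [q [pq lq uq oq]] := outside_path k1c con.
move: cyc; rewrite /= rcons_cat cat_path /= rcons_path => /andP[xa /and3P[pp1 l1 /and3P[yb pp2 l2]]].
apply: (@K23_model [:: x] [:: y] (a1 :: p1) (b1 :: p2) (k1 :: q)).
- have -> : flatten [:: [:: x]; [:: y]; a1 :: p1; b1 :: p2; k1 :: q] =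
      [:: x, y & (a1 :: p1) ++ (b1 :: p2) ++ k1 :: q] by rewrite /= cats0.
  rewrite (perm_uniq (perm_theta _ _ _ _ _)) cat_uniq uq uc andbT.
  by apply/hasPn => t tp; apply/negP => /oq; rewrite tp.
- by rewrite /= pp1 pp2 pq.
- by exists x, a1; rewrite !inE !eqxx.
- by exists x, (last b1 p2); rewrite rS l2 mem_last inE eqxx.
- by exists x, k1; rewrite !inE !eqxx.
- by exists y, (last a1 p1); rewrite rS l1 mem_last inE eqxx.
- by exists y, b1; rewrite !inE !eqxx.
- by exists y, k2; rewrite -lq mem_last inE eqxx lq.
Qed.

End LongestCycle.

(** The chord [ux] leaves two arcs with nonempty interiors. As there are five vertices, one interior
    has at least two and is split into two branch sets; the other interior is a single one. [a] and
    [b] are mere default values. *)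
Lemma chord_model c u x a b :
  cycle r (u :: c) -> uniq (u :: c) -> 5 <= size (u :: c) -> x \in c ->
  r u x -> x != head a c -> x != last b c -> has_model r C5_chord.
Proof.
move=> cyc uc sc xc ux.
case/splitPr: xc cyc uc sc => p1 p2 cyc uc sc.
case: p1 cyc uc sc => [|a1 p1] cyc uc sc; first by rewrite /= eqxx.
case: p2 cyc uc sc => [|b1 p2] cyc uc sc; first by rewrite last_cat /= eqxx.
move=> _ _; move: cyc; rewrite /= rcons_cat cat_path /= rcons_path.
move=> /andP[ua /and3P[pp1 l1 /and3P[xb pp2 l2]]].
case: p1 uc sc pp1 l1 => [|a2 p1] uc sc pp1 l1.
  (* Two interiors of one vertex each would give only four vertices. *)
  case: p2 uc sc pp2 l2 => [|b2 p2] uc sc pp2 l2; first by [].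
  move: pp2 => /= /andP[b12 pp2].
  apply: (@C5_chord_model [:: u] [:: a1] [:: x] [:: b1] (b2 :: p2)) => //=.
  - by rewrite cats0.
  - by rewrite pp2.
  - by exists u, a1; rewrite !inE !eqxx.
  - by exists a1, x; rewrite !inE !eqxx.
  - by exists x, b1; rewrite !inE !eqxx.
  - by exists b1, b2; rewrite !inE !eqxx.
  - by exists (last b2 p2), u; rewrite mem_last inE eqxx.
  - by exists u, x; rewrite !inE !eqxx.
move: pp1 => /= /andP[a12 pp1].
apply: (@C5_chord_model [:: u] (b1 :: p2) [:: x] (a2 :: p1) [:: a1]).
- by have /perm_uniq := perm_chord u x a1 (b1 :: p2) (a2 :: p1); rewrite uc => ->.
- by rewrite /= pp1 pp2.
- by exists u, (last b1 p2); rewrite rS l2 mem_last inE eqxx.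
- by exists b1, x; rewrite rS !inE !eqxx.
- by exists x, (last a2 p1); rewrite rS l1 mem_last inE eqxx.
- by exists a2, a1; rewrite rS !inE !eqxx.
- by exists a1, u; rewrite rS !inE !eqxx.
- by exists u, x; rewrite !inE !eqxx.
Qed.

Definition nonisolated : pred V := fun x => [exists y, r x y].

Lemma structure_theorem u a b d :
  (forall z x y, nonisolated x -> nonisolated y -> x != z -> y != z ->
    connect (avoiding z) x y) ->
  5 <= #|nonisolated| -> uniq [:: a; b; d] -> r u a -> r u b -> r u d ->
  has_model r C5_chord \/ has_model r K23.
Proof.
move=> conn2 big uabd ua ub ud.
have ni x y : r x y -> nonisolated x by move=> xy; apply/existsP; exists y.
have ni' x y : r x y -> nonisolated y by rewrite rS; apply: ni.
have neq x y : r x y -> x != y by apply: contraTneq => ->; rewrite rI.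
(* An edge run back and forth counts here as a cycle of length two, so length at least three is
   secured separately. *)
pose P n := [exists t : n.-tuple V, cycle r t && uniq t].
have Pc c : cycle r c -> uniq c -> P (size c).
  by move=> cyc uc; apply/existsP; exists (in_tuple c); rewrite /= cyc.
have Pmax n : P n -> n <= #|V|.
  by case/existsP=> t /andP[_ /card_uniqP e]; rewrite -(size_tuple t) -e max_card.
(* As [u] is no cut vertex, some path from [a] to [b] avoids [u] and closes up through [u]. *)
have [c3 [P3 le3]] : exists n, P n /\ 3 <= n.
  have nab : a != b by move: uabd; rewrite /= !inE negb_or => /and3P[/andP[]].
  have : connect (avoiding u) a b.
    by apply: conn2; [exact: ni' ua | exact: ni' ub | rewrite eq_sym; exact: neq..].
  case/connectP=> q0 hq0 lb; case/shortenP: hq0 lb => q hq uq _ lb.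
  have qu : u \notin a :: q.
    have au : a != u by rewrite eq_sym neq.
    elim: q a au hq {uq lb ua nab uabd} => [|k q IH] a' au /=; first by rewrite inE eq_sym au.
    by case/andP=> /and3P[_ _ ku] kq; rewrite inE eq_sym negb_or au IH.
  exists (size [:: u, a & q]); split; last by case: q {uq qu hq} lb nab => //= ->; rewrite eqxx.
  apply: Pc; last by rewrite cons_uniq qu uq.
  rewrite /= ua rcons_path -lb rS ub andbT.
  by apply: sub_path hq => x y /andP[].
have [n Pn nmax] := ex_maxnP (ex_intro _ c3 P3) Pmax.
have n3 : 3 <= n by apply: leq_trans le3 (nmax _ P3).
have longest c : cycle r c -> uniq c -> size c <= n by move=> h1 h2; apply/nmax/Pc.
case/existsP: Pn => -[c /= /eqP sc] /andP[cyc uc].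
have nic x : x \in c -> nonisolated x.
  by move=> xc; apply: ni (next_cycle cyc xc).
case: (boolP [exists d, nonisolated d && (d \notin c)]) => [/existsP[e /andP[nie ec]]|].
  right.
  (* Otherwise [z] would separate [e] from the other vertices of the cycle. *)
  have attach z : z \in c -> exists x k,
      [/\ x \in c, x != z, r x k & connect (outside c) e k].
    move=> zc; case: (boolP [exists x, exists k,
        [&& x \in c, x != z, r x k & connect (outside c) e k]]).
      by case/existsP=> x /existsP[k /and4P[*]]; exists x, k.
    rewrite negb_exists => /forallP none.
    have [y yc yz] : exists2 y, y \in c & y != z.
      case: c sc uc {cyc nic ec zc none} => [|y [|y' c]] /=; try by move=> h; move: n3; rewrite -h.
      move=> _; rewrite inE negb_or => /andP[/andP[nyy _] _].
      case: (eqVneq y z) => [yz|yz]; last by exists y; rewrite ?inE ?eqxx.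
      by exists y'; rewrite ?inE ?eqxx ?orbT // -yz eq_sym.
    have ez : e != z by apply: contraNneq ec => ->.
    pose Q t := (t \notin c) && connect (outside c) e t.
    suff step s t : avoiding z s t -> Q s -> Q t.
      have := connect_invariant step (conn2 z e y nie (nic y yc) ez yz).
      by rewrite /Q ec connect0 yc => /(_ isT).
    case/and3P=> st _ tz /andP[sc' es].
    have tc : t \notin c.
      apply/negP => tc; have := none t; rewrite negb_exists => /forallP/(_ s).
      by rewrite tc tz rS st es.
    rewrite /Q tc; apply: connect_trans es _; apply: connect1.
    by rewrite /outside st sc' tc.
  have [z zc] : exists z, z \in c.
    by case: c sc {cyc uc nic ec attach} => [h|z c _]; [move: n3; rewrite -h | exists z; rewrite inE eqxx].
  have [x [k [xc _ xk ek]]] := attach z zc.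
  (* Excluding [x] the second time makes the two ends of the ear distinct. *)
  have [y [l [yc yx yl el]]] := attach x xc.
  apply: (@ear_model n longest c x y k l) => //; first by rewrite eq_sym.
    have [q [_ <- _]] := outside_path ec ek; apply; exact: mem_last.
  by apply: connect_trans el; rewrite outside_sym.
rewrite negb_exists => /forallP span; left.
have {}span x : nonisolated x -> x \in c.
  by move=> nx; have := span x; rewrite nx negbK.
have c5 : 5 <= size c.
  apply: leq_trans big _; rewrite -(card_uniqP uc).
  by apply: subset_leq_card; apply/subsetP => x; apply: span.
have [i s cE] := rot_to (span u (ni _ _ ua)).
have {}cyc : cycle r (u :: s) by rewrite -cE rot_cycle.
have {}uc : uniq (u :: s) by rewrite -cE rot_uniq.
have {}c5 : 5 <= size (u :: s) by rewrite -cE size_rot.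
have ins x : r u x -> x \in s.
  move=> ux; have := span _ (ni' _ _ ux); rewrite -(mem_rot i) cE inE eq_sym.
  by rewrite (negPf (neq _ _ ux)).
(* At most two of the three neighbours of [u] are next to it on the cycle, so one of them spans a
   chord. *)
have [x ux /andP[xh xl]] : exists2 x, r u x & (x != head u s) && (x != last u s).
  move: uabd; rewrite /= !inE negb_or andbT => /andP[/andP[nab nad] nbd].
  case: (boolP ((a != head u s) && (a != last u s))) => [|na]; first by exists a.
  case: (boolP ((b != head u s) && (b != last u s))) => [|nb]; first by exists b.
  exists d => //; move: na nb; rewrite !negb_and !negbK.
  case/orP=> /eqP ea /orP[]/eqP eb;
    by first [rewrite ea eb eqxx in nab | rewrite !(eq_sym d) -ea -eb nad nbd].
exact: (chord_model cyc uc c5 (ins _ ux) ux xh xl).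
Qed.

End Structure.

(** * The polarised inequality *)

Section Polarised.
Variables (V E : finType).
Implicit Types (g : E -> V * V) (T : {set V}) (F : {set E}).

Definition linked_by g F : rel V := fun x y =>
  (x != y) && [exists e in F, joins g e x y].

Definition forbidden (r : rel V) : Prop := has_model r C5_chord \/ has_model r K23.

Lemma linked_by_sym g F : symmetric (linked_by g F).
Proof.
move=> x y; rewrite /linked_by eq_sym; congr (_ && _).
by apply: eq_existsb => e; rewrite joinsC.
Qed.

Lemma linked_by_irr g F : irreflexive (linked_by g F).
Proof. by move=> x; rewrite /linked_by eqxx. Qed.

Lemma linked_edge g F e x y : x != y -> e \in F -> joins g e x y -> linked_by g F x y.
Proof. by rewrite /linked_by => -> eF je; apply/existsP; exists e; rewrite eF. Qed.

Lemma forbidden_sub (r r' : rel V) : subrel r r' -> forbidden r -> forbidden r'.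
Proof. by move=> rr' [] h; [left|right]; apply: model_sub h. Qed.

Lemma linked_by_sub g F F' : F \subset F' -> subrel (linked_by g F) (linked_by g F').
Proof.
move=> /subsetP FF' x y /andP[nxy /existsP[e /andP[eF je]]].
exact: linked_edge nxy (FF' _ eF) je.
Qed.

Lemma forbidden_contract g F e x y : x != y -> e \in F -> joins g e x y ->
  forbidden (linked_by (contract_ends x y g) (F :\ e)) -> forbidden (linked_by g F).
Proof.
move=> nxy eF je; have xy := linked_edge nxy eF je.
have lift a b : linked_by (contract_ends x y g) (F :\ e) a b ->
    exists u v, [/\ identify x y u = a, identify x y v = b & linked_by g F u v].
  case/andP=> nab /existsP[f /andP[]]; rewrite !inE => /andP[_ fF] /ends_cases jf.
  have nends : (g f).1 != (g f).2.
    apply: contraNneq nab => h; case: jf; rewrite /contract_ends h => -[<- <-] //.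
  have l := linked_edge nends fF (joins_ends g f).
  case: jf => -[<- <-]; first by exists (g f).1, (g f).2.
  by exists (g f).2, (g f).1; rewrite linked_by_sym.
by case=> h; [left|right];
  exact: (model_contract (@linked_by_sym g F) xy lift h).
Qed.

Local Open Scope ring_scope.

Lemma total_gap_refl g T F v : 0 <= total_gap g T F v v.
Proof. by apply: sumr_ge0 => c _; rewrite /gap conn_refl; case: conn. Qed.

(** Without an edge at [v], a walk from [v] can only move between its two copies, so both terms of
    the gap vanish. *)
Lemma total_gap_isolated g T F v w : v != w ->
  (forall e, e \in F -> (g e).1 != (g e).2) ->
  ~~ nonisolated (linked_by g F) v -> 0 <= total_gap g T F v w.
Proof.
move=> nvw noloop iso; apply: sumr_ge0 => c _.
suff h j : conn g T (polar F c) (v, false) (w, j) = false by rewrite /gap !h.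
apply/negP => cvw; pose P (a : V * bool) := a.1 == v.
suff step a b : layers g T (polar F c) a b -> P a -> P b.
  by have := connect_invariant step cvw; rewrite /P /= eqxx eq_sym (negPf nvw) => /(_ isT).
rewrite /P => /orP[/andP[/eqP -> _]|/existsP[e /and3P[_ /andP[eF _] je]] /eqP av] //.
case/negP: iso; apply/existsP; exists b.1; rewrite -av.
apply: (linked_edge _ eF je); have := noloop e eF.
by case/ends_cases: je => -> //=; rewrite eq_sym.
Qed.

(** Induction on [#|F|]. The reductions are tried in turn, so each case may assume that the earlier
    ones fail; the last one, with all degrees two and every vertex other than [v] and [w] in [T], is
    contradictory. *)
Lemma total_gap_ge0 g T F v w :
  ~ forbidden (linked_by g F) -> 0 <= total_gap g T F v w.
Proof.
have [n] := ubnP #|F|; elim: n g T F v w => // n IH g T F v w; rewrite ltnS => ltn ok.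
have subIH F' T' v' w' : F' \proper F -> 0 <= total_gap g T' F' v' w'.
  move=> pF; apply: IH; first exact: leq_trans (proper_card pF) ltn.
  move=> bad; apply: ok; apply: forbidden_sub bad.
  exact/linked_by_sub/proper_sub.
have conIH e x y T' v' w' : x != y -> e \in F -> joins g e x y ->
    0 <= total_gap (contract_ends x y g) T' (F :\ e) v' w'.
  move=> nxy eF je; apply: IH; first by apply: leq_trans ltn; apply/proper_card/properD1.
  by move/(forbidden_contract nxy eF je).
case: (boolP [exists e in F, (g e).1 == (g e).2]) => [/existsP[e /andP[eF /eqP le]]|].
  by rewrite -(total_gap_loop _ _ _ _ le); apply/subIH/properD1.
rewrite negb_exists => /forallP noloop0.
have noloop e : e \in F -> (g e).1 != (g e).2.
  by move=> eF; have := noloop0 e; rewrite eF.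
have jneq e x y : e \in F -> joins g e x y -> x != y.
  by move=> /noloop ne /ends_cases[] h; rewrite h //= eq_sym in ne *.
have jlink e x y : e \in F -> joins g e x y -> linked_by g F x y.
  by move=> eF je; apply: (linked_edge _ eF je); apply: jneq eF je.
have [<-|nvw] := eqVneq v w; first exact: total_gap_refl.
case: (boolP [exists e in F, exists e' in F, exists x, exists y,
   [&& e != e', joins g e x y & joins g e' x y]]).
  case/existsP=> e /andP[eF /existsP[e' /andP[e'F /existsP[x /existsP[y /and3P[ne je je']]]]]].
  apply: (parallel_ge0 eF e'F ne je je'); first exact/subIH/properD1.
  by apply: conIH => //; apply: jneq je.
move=> nopar; have simple e e' x y : e \in F -> e' \in F -> joins g e x y ->
    joins g e' x y -> e = e'.
  move=> eF e'F je je'; apply/eqP/negPn/negP => ne; case/negP: nopar.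
  apply/existsP; exists e; rewrite eF; apply/existsP; exists e'; rewrite e'F.
  by apply/existsP; exists x; apply/existsP; exists y; rewrite ne je je'.
case: (boolP [exists e in F, ((g e).1 \in T) && ((g e).2 \in T)]).
  case/existsP=> e /andP[eF /andP[xT yT]].
  have je := joins_ends g e.
  by apply: (posts_ge0 eF je xT yT); apply: conIH => //; apply: noloop.
rewrite negb_exists => /forallP noTT0; set r := linked_by g F.
have noTT x y : r x y -> x \in T -> y \notin T.
  case/andP=> _ /existsP[e /andP[eF je]] xT; have := noTT0 e; rewrite eF /=.
  by case/ends_cases: je => -> /=; rewrite xT ?andbT.
have rS : symmetric r := @linked_by_sym g F.
have rI : irreflexive r := @linked_by_irr g F.
case: (boolP [forall z, forall x, forall y, [&& nonisolated r x, nonisolated r y, x != z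
    & y != z] ==> connect (avoiding r z) x y]); last first.
  rewrite negb_forall => /existsP[z]; rewrite negb_forall => /existsP[x].
  rewrite negb_forall => /existsP[y]; rewrite negb_imply.
  case/andP=> /and4P[/existsP[x' xx'] /existsP[y' yy'] xz yz] nxy.
  (* [K] is the component of [x] after the removal of [z]; the sides [A] and [B] below share exactly
     [z]. *)
  pose K := [set t | connect (avoiding r z) x t].
  have Kz t : t \in K -> t != z.
    rewrite inE => xt; suff step a b : avoiding r z a b -> a != z -> b != z.
      exact: connect_invariant step _ _ xt xz.
    by case/and3P.
  have Kstep a b : r a b -> a \in K -> b != z -> b \in K.
    move=> ab aK bz; have az := Kz _ aK; move: aK; rewrite !inE => xa.
    by apply: connect_trans xa _; apply: connect1; rewrite /avoiding ab az.
  have xK : x \in K by rewrite inE connect0.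
  have yK : y \notin K by rewrite inE.
  pose A := z |: K; pose B := ~: K.
  pose F1 := [set e in F | ((g e).1 \in K) || ((g e).2 \in K)].
  have zB : z \in B by rewrite inE; apply/negP => /Kz; rewrite eqxx.
  have zA : z \in A by rewrite !inE eqxx.
  have AB t : (t \in A) || (t \in B) by rewrite !inE -orbA orbN orbT.
  have capAB t : t \in A -> t \in B -> t = z.
    by rewrite in_setU1 in_setC => /orP[/eqP|->].
  have dis : [disjoint F1 & F :\: F1].
    by rewrite disjoints_subset; apply/subsetP => e eF1; rewrite in_setC in_setD eF1.
  have F12 : F = F1 :|: F :\: F1.
    by apply/setP => e; rewrite !inE; case: (e \in F); rewrite //= andbT orbN.
  have A1 e : e \in F1 -> ((g e).1 \in A) && ((g e).2 \in A).
    rewrite inE => /andP[eF]; have l := jlink _ _ _ eF (joins_ends g e).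
    case/orP=> h; rewrite !in_setU1 h orbT ?andbT /=.
      by case: eqP => //= /eqP nz; apply: Kstep l h nz.
    by case: eqP => //= /eqP nz; apply: Kstep _ h nz; rewrite rS.
  have B2 e : e \in F :\: F1 -> ((g e).1 \in B) && ((g e).2 \in B).
    by rewrite !inE => /andP[+ eF]; rewrite eF /= negb_or.
  (* An edge at [y] is missing from [F1], and an edge at [x] from its complement, so the induction
     hypothesis applies to both sides. *)
  have p1 : F1 \proper F.
    apply/properP; split; first by apply/subsetP => e; rewrite inE => /andP[].
    case/andP: yy' => _ /existsP[e /andP[eF je]]; exists e; rewrite // inE eF /=.
    have nK : y' \notin K.
      apply/negP => y'K; case/negP: yK; apply: Kstep y'K yz.
      by rewrite rS; apply: jlink eF je.
    by case/ends_cases: je => -> /=; rewrite (negPf yK) (negPf nK).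
  have p2 : F :\: F1 \proper F.
    apply/properP; split; first by apply/subsetP => e; rewrite inE => /andP[].
    case/andP: xx' => _ /existsP[e /andP[eF je]]; exists e => //.
    rewrite in_setD eF andbT negbK [e \in F1]inE eF /=.
    by case/ends_cases: je => -> /=; rewrite xK ?orbT.
  have across v' w' : v' \in A -> w' \in B -> 0 <= total_gap g T F v' w'.
    by move=> vA wB; apply: (cut_across_ge0 AB capAB zB F12 dis A1 B2 vA wB); apply: subIH.
  case: (boolP (v \in A)) => vA; case: (boolP (w \in A)) => wA.
  - by apply: (cut_same_side_ge0 AB capAB F12 dis A1 B2 vA wA); apply: subIH.
  - by apply: across => //; have := AB w; rewrite (negPf wA).
  - by rewrite total_gapC; apply: across => //; have := AB v; rewrite (negPf vA).
  have vB : v \in B by have := AB v; rewrite (negPf vA).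
  have wB : w \in B by have := AB w; rewrite (negPf wA).
  apply: (@cut_same_side_ge0 _ _ g T z B A F (F :\: F1) F1) => //; try exact: subIH.
  - by move=> t; rewrite orbC.
  - by move=> t tB tA; apply: capAB.
  - by rewrite setUC.
  - by rewrite disjoint_sym.
move=> conn2_; have conn2 z x y : nonisolated r x -> nonisolated r y -> x != z -> y != z ->
    connect (avoiding r z) x y.
  by move=> *; apply: (implyP (forallP (forallP (forallP conn2_ z) x) y)); apply/and4P.
case: (boolP (nonisolated r v)) => niv; last exact: total_gap_isolated.
case: (boolP (nonisolated r w)) => niw; last first.
  by rewrite total_gapC; apply: total_gap_isolated; rewrite // eq_sym.
have rni x y : r x y -> nonisolated r y by rewrite rS => h; apply/existsP; exists x.
pose rest := [set x | [&& nonisolated r x, x != v & x != w]].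
have cardW : #|nonisolated r| = (#|rest|.+2)%N.
  have vW : v \in nonisolated r by [].
  have wW : w \in [predD1 nonisolated r & v] by rewrite inE /= eq_sym nvw.
  rewrite (cardD1 v) vW (cardD1 w [predD1 _ & v]) wW !add1n; congr (_.+2).
  by apply: eq_card => x; rewrite !inE; case: (x == w); case: (x == v);
    rewrite /= ?andbF ?andbT.
case: (leqP #|rest| 2) => [small|big].
  apply: (@small_ge0 _ _ g T F v w (enum rest)) => //.
  - by rewrite /= !inE !mem_enum !inE !eqxx (negPf nvw) /= !andbF enum_uniq.
  - by rewrite -cardE.
  - have mem x : nonisolated r x -> x \in [:: v, w & enum rest].
      by move=> nx; rewrite !inE mem_enum inE nx; do 2!case: eqP.
    move=> e eF; have l := jlink _ _ _ eF (joins_ends g e).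
    by rewrite !mem ?noloop //; [apply: rni l | apply: (rni (g e).2); rewrite rS].
case: (boolP [exists u, 2 < #|[set y | r u y]|]%N).
  case/existsP=> u /card_gt2P[a [b [d [[]]]]]; rewrite !inE => ua ub ud [nab nbd nda].
  case: ok; apply: (structure_theorem rS rI conn2 _ _ ua ub ud); first by rewrite cardW.
  by rewrite /= !inE negb_or nab nbd eq_sym nda.
rewrite negb_exists => /forallP deg_le2.
(* A vertex with a single neighbour [z] would be cut off by [z] from some third vertex, which exists
   because [rest] has at least three elements. *)
have deg2 u : nonisolated r u -> #|[set y | r u y]| = 2%N.
  case/existsP=> z uz; apply/eqP; rewrite eqn_leq leqNgt deg_le2 /=.
  rewrite leqNgt; apply/negP => le1.
  have zE t : r u t -> t = z.
    move=> ut; apply/eqP/negPn/negP => tz; move: le1; rewrite ltnNge => /negP; apply.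
    by apply/card_gt1P; exists t, z; rewrite !inE.
  have [y nry yuz] : exists2 y, y \in rest & y \notin [set u; z].
    apply/subsetPn; apply: contraL big => /subset_leq_card h.
    by rewrite -leqNgt; apply: leq_trans h _; rewrite cards2; case: eqP.
  move: nry yuz; rewrite !inE negb_or => /and3P[nry _ _] /andP[yu yz].
  have uz' : u != z by apply: contraTneq uz => ->; rewrite rI.
  have niu : nonisolated r u by apply/existsP; exists z.
  have /connectP[[|t p] /=] := conn2 z u y niu nry uz' yz.
    by move=> _ e; rewrite e eqxx in yu.
  by case/andP=> /and3P[/zE-> _]; rewrite eqxx.
case: (boolP [exists u in rest, u \notin T]) => [/existsP[u /andP[ur uT]]|].
  move: ur; rewrite inE => /and3P[niu nuv nuw].
  have /eqP/cards2P[x [y [nxy /setP N]]] := deg2 u niu.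
  have [ux uy] : r u x /\ r u y by move: (N x) (N y); rewrite !inE !eqxx orbT.
  have [e eF je] : exists2 e, e \in F & joins g e x u.
    by move: ux; rewrite rS => /andP[_ /existsP[e /andP[]]]; exists e.
  have [e' e'F je'] : exists2 e', e' \in F & joins g e' u y.
    by case/andP: uy => _ /existsP[e' /andP[]]; exists e'.
  have nux : u != x by apply: contraTneq ux => ->; rewrite rI.
  have nuy : u != y by apply: contraTneq uy => ->; rewrite rI.
  have nee' : e != e'.
    apply: contraNneq nxy => ee'; move: je je'; rewrite -ee' /joins.
    case/orP=> /eqP -> /orP[]; rewrite xpair_eqE => /andP[/eqP h /eqP h'].
    - by rewrite h eqxx in nux.
    - by rewrite h.
    - by rewrite h'.
    - by rewrite h eqxx in nuy.
  apply: (series_ge0 eF e'F nee' je je' nux nuy uT nuv nuw).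
  - move=> f z fF jf; have := N z; rewrite !inE [r u z](jlink _ _ _ fF jf).
    case/esym/orP=> /eqP zE; rewrite zE in jf; [left|right]; last exact: simple jf je'.
    by rewrite joinsC in jf; apply: simple jf je.
  - apply: subIH; apply: sub_proper_trans (properD1 eF); exact: subD1set.
  - by apply: conIH => //; rewrite eq_sym.
rewrite negb_exists => /forallP restT.
have {}restT t : t \in rest -> t \in T by move=> tr; have := restT t; rewrite tr negbK.
(* No edge lies inside [T], which contains [rest], so each vertex of [rest] has exactly the
   neighbours [v] and [w]. Then [v] has more than two neighbours. *)
suff : (2 < #|[set y | r v y]|)%N by rewrite (deg2 v niv).
apply: leq_trans big _; apply: subset_leq_card; apply/subsetP => t tr.
have tT := restT t tr; move: (tr); rewrite !inE => /and3P[nit _ _].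
have sub : [set y | r t y] \subset [set v; w].
  apply/subsetP => y; rewrite !inE => ty; apply/negPn/negP; rewrite negb_or => /andP[yv yw].
  case/negP: (noTT t y ty tT); apply: restT; by rewrite inE (rni _ _ ty) yv yw.
have : [set y | r t y] == [set v; w].
  by rewrite eqEcard sub deg2 // cards2; case: eqP.
by move/eqP/setP/(_ v); rewrite !inE eqxx rS.
Qed.

End Polarised.

(** * The percolation inequality *)

Lemma eq_sum_ge0 (I : finType) (H K : I -> int) :
  (forall i, H i = K i) -> (0 <= \sum_i H i -> 0 <= \sum_i K i)%R.
Proof. by move=> HK; rewrite (eq_bigr K). Qed.

(** Edges of [C] are open in both layers and merge their ends; they are contracted one by one, or
    dropped if loops, until the model is polarised. *)
Lemma mixed_gap_ge0 (V E : finType) (g : E -> V * V) (T : {set V})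
    (C F : {set E}) v w :
  ~ forbidden (linked_by g (C :|: F)) ->
  (0 <= \sum_(c : {ffun E -> bool})
    gap g T (fun e i => (e \in C) || polar F c e i) v w)%R.
Proof.
have [n] := ubnP #|C|; elim: n g T C F v w => // n IH g T C F v w ltn ok.
have [C0|[e eC]] := set_0Vmem C.
  rewrite C0 set0U in ok.
  apply: eq_sum_ge0 (total_gap_ge0 T v w ok) => c.
  by apply: eq_gap => e i; rewrite C0 inE.
have ltC : #|C :\ e| < n by rewrite (cardsD1 e C) eC in ltn.
have CF1 : C :\ e :|: F :\ e = (C :|: F) :\ e by rewrite setDUl.
have opE (c : {ffun E -> bool}) e' i :
    (e' != e) && ((e' \in C) || polar F c e' i) =
    (e' \in C :\ e) || polar (F :\ e) c e' i.
  by rewrite polarD1 !inE; case: eqP.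
have [le|ne] := eqVneq (g e).1 (g e).2.
  apply: eq_sum_ge0 (IH g T (C :\ e) (F :\ e) v w ltC _) => [c|]; last first.
    rewrite CF1 => bad; apply: ok; apply: forbidden_sub bad.
    exact/linked_by_sub/subD1set.
  rewrite [RHS](gap_loop _ _ _ _ le).
  by apply: eq_gap => e' i; rewrite opE.
have je := joins_ends g e; have eCF : e \in C :|: F by rewrite inE eC.
pose x := (g e).1; pose y := (g e).2.
apply: eq_sum_ge0 (IH (contract_ends x y g) (identify x y @: T) (C :\ e) (F :\ e)
    (identify x y v) (identify x y w) ltC _) => [c|]; last first.
  by rewrite CF1 => /(forbidden_contract ne eCF je).
rewrite [RHS](gap_contract_edge (op' := fun e i => (e \in C) || polar F c e i) _ _ je) //.
  by apply: eq_gap => e' i; rewrite opE.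
by move=> i; apply: conn_edge je; rewrite eC.
Qed.

Section Percolation.
Variables (G : sgraph) (v0 : G).
Local Notation E := {set G}.

(** An orientation is chosen for each edge; [v0] is the default for sets that are not edges. *)
Definition ends (e : E) : G * G :=
  odflt (v0, v0) [pick u : G * G | adj u.1 u.2 && (e == [set u.1; u.2])].

Lemma endsP (e : E) : e \in edges G ->
  adj (ends e).1 (ends e).2 /\ e = [set (ends e).1; (ends e).2].
Proof.
move=> /imsetP[u uA eu]; rewrite /ends; case: pickP => [u' /andP[ad /eqP eu']|/(_ u)].
  by split.
by rewrite inE in uA; rewrite eu eqxx andbT => /negbT/negP/(_ uA).
Qed.

Lemma edge_in (x y : G) : adj x y -> [set x; y] \in edges G.
Proof. by move=> xy; apply/imsetP; exists (x, y); rewrite ?inE. Qed.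

Definition present (omega : outcome G) (e : E) (i : bool) :=
  (e \in edges G) && ((e, i) \in omega).

Lemma conn_present (T : {set G}) omega a b :
  connect (@adj (perc_graph T omega)) a b = conn ends T (present omega) a b.
Proof.
apply/idP/idP.
  apply: connect_sub => -[x i] [y j]; rewrite /= /perc_rel /= /bunkbed_rel /=.
  case: (eqVneq i j) => [->|nij] /=; last first.
    by case/andP=> /andP[/eqP-> _]; apply: conn_post.
  rewrite andbF orbF => /andP[xy xyo].
  apply: (@conn_edge _ _ _ _ _ [set x; y]); first by rewrite /present edge_in.
  have [_ /eqP] := endsP (edge_in xy); rewrite eq_pair_set /joins.
  case/orP=> /andP[/eqP h1 /eqP h2]; rewrite (surjective_pairing (ends _)) -h1 -h2 eqxx ?orbT //.
apply: (@conn_hom _ _ _ _ id) => [|x xT|e i /andP[eE eo]].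
- exact/sym_connect_sym/perc_sym.
- by apply: connect1; rewrite /= /perc_rel /= /bunkbed_rel /= eqxx andbT.
have [ad eq] := endsP eE; apply: connect1.
by rewrite /= /perc_rel /= /bunkbed_rel /= eqxx ad -eq.
Qed.

(** * Reversing the layers of chosen edges *)

Definition flip (c : {ffun E -> bool}) (h : E * bool) := (h.1, h.2 (+) c h.1).

Lemma flipK c : involutive (flip c).
Proof. by move=> [e i]; rewrite /flip /= addbK. Qed.

Definition flip_outcome c (omega : outcome G) : outcome G := flip c @^-1: omega.

Lemma flip_outcomeK c : involutive (flip_outcome c).
Proof. by move=> omega; apply/setP => h; rewrite !inE flipK. Qed.

Lemma flip_horizontal c h : (flip c h \in horizontal G) = (h \in horizontal G).
Proof. by rewrite !inE. Qed.

Lemma flip_powerset c omega :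
  (flip_outcome c omega \in powerset (horizontal G)) =
  (omega \in powerset (horizontal G)).
Proof.
suff imp (omega' : outcome G) : omega' \subset horizontal G -> flip_outcome c omega' \subset horizontal G.
  by rewrite !powersetE; apply/idP/idP => /imp //; rewrite flip_outcomeK.
by move/subsetP=> h; apply/subsetP => x; rewrite inE => /h; rewrite flip_horizontal.
Qed.

Local Open Scope ring_scope.

Lemma sum_flip_ge0 (T : {set G}) (omega : outcome G) (w : G) :
  ~ forbidden (@adj G) ->
  0 <= \sum_c gap ends T (present (flip_outcome c omega)) v0 w.
Proof.
move=> ok; pose C := [set e in edges G | ((e, false) \in omega) && ((e, true) \in omega)].
pose F := [set e in edges G | ((e, false) \in omega) (+) ((e, true) \in omega)].
(* For an edge of [F], [base] records the layer of its only copy; shifting the reversal by [base]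
   makes that copy land in layer [c e]. *)
pose base : {ffun E -> bool} := [ffun e => (e, true) \in omega].
have okCF : ~ forbidden (linked_by ends (C :|: F)).
  move=> bad; apply: ok; apply: forbidden_sub bad => x y /andP[_ /existsP[e /andP[eCF je]]].
  have eE : e \in edges G by move: eCF; rewrite !inE => /orP[] /andP[].
  by have [+ _] := endsP eE; case/ends_cases: je => -> //=; rewrite adj_sym.
rewrite (sum_xorf base); apply: eq_sum_ge0 (mixed_gap_ge0 T v0 w okCF) => c.
apply: eq_gap => e i.
rewrite /polar /present /flip_outcome !inE /flip /= !ffunE; case: (e \in edges G) => //=.
by case: (c e); case: i; case o1: ((e, true) \in omega);
  case o0: ((e, false) \in omega); rewrite /= ?o1 ?o0.
Qed.

Variables (R : realType) (p : E -> R).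

(** Both copies of an edge carry the same probability, so a reversal only permutes the factors. *)
Lemma perc_weight_flip c omega :
  perc_weight p (flip_outcome c omega) = perc_weight p omega.
Proof.
rewrite /perc_weight [RHS](reindex_inj (inv_inj (flipK c))).
apply: eq_big => [h|h _]; first by rewrite flip_horizontal.
by rewrite inE.
Qed.

Lemma perc_weight_ge0 omega :
  (forall e, e \in edges G -> 0 <= p e <= 1) -> 0 <= perc_weight p omega.
Proof.
move=> p01; apply: prodr_ge0 => h; rewrite inE => /andP[/p01/andP[p0 p1] _].
by case: ifP; rewrite ?subr_ge0.
Qed.

Lemma bunkbed_ineq_of_minor_free (T : {set G}) (w : G) :
  ~ forbidden (@adj G) -> (forall e, e \in edges G -> 0 <= p e <= 1) ->
  bunkbed_ineq T p v0 w.
Proof.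
move=> ok p01; rewrite /bunkbed_ineq -subr_ge0.
pose D omega : R := (gap ends T (present omega) v0 w)%:~R.
have -> : prob_connected T p (v0, false) (w, false) -
    prob_connected T p (v0, false) (w, true) =
    \sum_(omega in powerset (horizontal G)) perc_weight p omega * D omega.
  rewrite /prob_connected /perc_prob !big_mkcondr -sumrB; apply: eq_bigr => omega _ /=.
  rewrite !conn_present /D /gap.
  by do 2!case: conn; rewrite /= ?subrr ?subr0 ?sub0r ?mulr0 ?mulr1 ?mulrN1.
(* The expectation is multiplied by the number of reversals, one copy is reindexed by each of them,
   and the resulting sum is nonnegative outcome by outcome. *)
rewrite -(@pmulrn_lge0 _ _ #|{ffun E -> bool}|); last first.
  by apply/card_gt0P; exists [ffun => true].
rewrite -sumr_const.
rewrite (eq_bigr (fun c => \sum_(omega in powerset (horizontal G))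
   perc_weight p omega * D (flip_outcome c omega))) => [|c _]; last first.
  rewrite (reindex_inj (inv_inj (flip_outcomeK c))).
  apply: eq_big => [omega|omega _]; first exact: flip_powerset.
  by rewrite perc_weight_flip.
rewrite exchange_big; apply: sumr_ge0 => omega _; rewrite -mulr_sumr.
apply: mulr_ge0; first exact: perc_weight_ge0.
by rewrite /D -rmorph_sum ler0z; apply: sum_flip_ge0.
Qed.

End Percolation.

(** * The diamond inside both forbidden graphs *)

Lemma diamond_adj (i j : diamond) :
  adj i j = (i != j) && ~~ ((2 <= i) && (2 <= j)).
Proof.
move: i j => [[|[|[|[|i]]]] // ?] [[|[|[|[|j]]]] // ?];
by rewrite /= /del_edge_rel /= eq_pair_set -?val_eqE /= ?inordK.
Qed.

Lemma C5_chord_adj i j : i < 5 -> j < 5 -> adj (inord i : C5_chord) (inord j) =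
  ((i, j) \in [:: (0, 1); (1, 2); (2, 3); (3, 4); (4, 0); (0, 2);
                  (1, 0); (2, 1); (3, 2); (4, 3); (0, 4); (2, 0)]).
Proof.
move=> i5 j5; rewrite /= /add_edge_rel eq_pair_set /= /cycle_rel -!val_eqE /=.
rewrite !inordK //.
by case: i j i5 j5 => [|[|[|[|[|i]]]]] [|[|[|[|[|j]]]]].
Qed.

Lemma diamond_model (G : sgraph) (s0 s1 s2 s3 : seq G) :
  uniq (flatten [:: s0; s1; s2; s3]) -> all (sorted (@adj G)) [:: s0; s1; s2; s3] ->
  touch (@adj G) s0 s1 -> touch (@adj G) s0 s2 -> touch (@adj G) s0 s3 ->
  touch (@adj G) s1 s2 -> touch (@adj G) s1 s3 -> has_model (@adj G) diamond.
Proof.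
move=> us sorts t01 t02 t03 t12 t13.
apply: (@model_of_paths _ _ (@adj_sym G) diamond (@nat_of_ord 4) _ _ us sorts).
  exact: ord_inj.
move=> i j; rewrite diamond_adj; move: i j.
move=> [[|[|[|[|i]]]] // ?] [[|[|[|[|j]]]] // ?] //= _;
by [|apply: touchC => //; exact: adj_sym].
Qed.

(** Contracting the edge between 3 and 4 leaves two triangles on the chord. *)
Lemma C5_chord_diamond : has_model (@adj C5_chord) diamond.
Proof.
pose o k : C5_chord := inord k.
apply: (@diamond_model _ [:: o 0] [:: o 2] [:: o 1] [:: o 3; o 4]).
- by rewrite /= !inE -!val_eqE /= !inordK.
- have o34 : adj (o 3) (o 4) by rewrite C5_chord_adj.
  by rewrite /= !andbT; exact: o34.
- by exists (o 0), (o 2); rewrite !inE !eqxx C5_chord_adj.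
- by exists (o 0), (o 1); rewrite !inE !eqxx C5_chord_adj.
- by exists (o 0), (o 4); rewrite !inE !eqxx orbT C5_chord_adj.
- by exists (o 2), (o 1); rewrite !inE !eqxx C5_chord_adj.
- by exists (o 2), (o 3); rewrite !inE !eqxx C5_chord_adj.
Qed.

(** Contracting the edge from [a 1] to [b 2] creates the edge between the vertices of degree
    three. *)
Lemma K23_diamond : has_model (@adj K23) diamond.
Proof.
pose a k : K23 := inl (inord k); pose b k : K23 := inr (inord k).
apply: (@diamond_model _ [:: a 0] [:: a 1; b 2] [:: b 0] [:: b 1]).
- rewrite /= !inE /a /b; do ?[rewrite (inj_eq (@inl_inj _ _)) | rewrite (inj_eq (@inr_inj _ _))].
  by rewrite -?val_eqE /= !inordK.
- by [].
- by exists (a 0), (b 2); rewrite !inE !eqxx orbT.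
- by exists (a 0), (b 0); rewrite !inE !eqxx.
- by exists (a 0), (b 1); rewrite !inE !eqxx.
- by exists (a 1), (b 0); rewrite !inE !eqxx.
- by exists (a 1), (b 1); rewrite !inE !eqxx.
Qed.

Theorem theorem4 (R : realType) (G : sgraph) :
  ~ strong_bunkbed R G ->
  has_minor G diamond /\ (has_minor G C5_chord \/ has_minor G K23).
Proof.
move=> nsb; have bad : forbidden (@adj G).
  apply: contrapT => ok; apply: nsb => T p p01 v w.
  exact: bunkbed_ineq_of_minor_free.
split.
  apply: model_minor => [[[|[|[|[|i]]]] // h]|].
  - by exists (inord 1); rewrite diamond_adj -val_eqE /= inordK.
  - by exists (inord 0); rewrite diamond_adj -val_eqE /= inordK.
  - by exists (inord 0); rewrite diamond_adj -val_eqE /= inordK.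
  - by exists (inord 0); rewrite diamond_adj -val_eqE /= inordK.
  by case: bad => h; apply: model_trans h _; [exact: C5_chord_diamond | exact: K23_diamond].
case: bad => h; [left | right]; apply: model_minor h => h.
  have hE : h = inord h by apply: val_inj; rewrite /= inordK.
  by case: h hE => [[|[|[|[|[|i]]]]] // ?] ->;
    [exists (inord 1)|exists (inord 2)|exists (inord 3)|exists (inord 4)|exists (inord 0)];
    rewrite C5_chord_adj ?inordK.
by case: h => h; [exists (inr ord0) | exists (inl ord0)].
Qed.
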